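(* Fix a system $i$, assume $d[j]=1$ for $j\ge2$, let $\lambda[j]$, $j=1,\dots,L$, be the optimal Lagrange multipliers of the communication constraints, and use the certainty-equivalence controller $u^i_k=-L^i_k\hat x^i_{k|k}[L+1]$. For each scheduler $j\in\{1,\dots,L\}$ define the distributed value of information $$\mathbf{dVoI}^i_k[j]=\lambda[j]-(\tilde x^i_{k|k}[j])^\top(A_i^{L+1-j})^\top\Gamma^i_{k+(L+1-j)}A_i^{L+1-j}\tilde x^i_{k|k}[j],$$ and the policy $\delta^{i\star}_k[j]=1$ if $k\le T-(L+1-j)$ and $\mathbf{dVoI}^i_k[j]<0$, and $\delta^{i\star}_k[j]=0$ otherwise. Then this dVoI-based policy outperforms the periodic policy $\bar\pi^i[j]$ ($\delta^i_k[j]=1$ for all $0\le k\le T-1$) for the problem of minimizing $J^i(\mu^\star,\pi^i)+\sum_{j=1}^L\lambda[j]\,\mathbb E[\sum_{k=0}^{T-1}\delta^i_k[j]]$, i.e., it attains a cost no larger than that of the periodic policy.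
   Context: Setting: $N$ systems $x^i_{k+1}=A_ix^i_k+B_iu^i_k+w^i_k$, $y^i_k=C_ix^i_k+v^i_k$ with independent Gaussian noises and independent zero-mean initial state; each loop closed over an $L$-hop network with schedulers $\mathcal S^i[1],\dots,\mathcal S^i[L]$ choosing $\delta^i_k[j]\in\{0,1\}$ and controller $\mathcal C^i$ (decision maker $L+1$); delays $d[1]=0$, $d[j]=1$ for $j\ge2$. Scheduler 1 runs the Kalman filter $\hat x^i_{k|k}[1]=A_i\hat x^i_{k-1|k-1}[1]+B_iu^i_{k-1}+\zeta^i_k$ (innovation $\zeta^i_k$); for $j\ge2$, $\hat x^i_{k|k}[j]=A_i\hat x^i_{k-1|k-1}[j-1]+B_iu^i_{k-1}$ if $\delta^i_{k-1}[j-1]=1$, else $A_i\hat x^i_{k-1|k-1}[j]+B_iu^i_{k-1}$ (control history known to all). Mismatch error $\tilde x^i_{k|k}[j]=\hat x^i_{k|k}[j]-\hat x^i_{k|k}[j+1]$. Cost $J^i=\mathbb E[(x^i_T)^\top\Lambda_ix^i_T+\sum_{k=0}^{T-1}(x^i_k)^\top Q_ix^i_k+(u^i_k)^\top R_iu^i_k]$; communication constraints $\sum_{i=1}^N\mathbb E[\sum_{k=0}^{T-1}\delta^i_k[j]]\le R[j]$. $S^i_k=Q_i+A_i^\top(S^i_{k+1}-S^i_{k+1}B_i(R_i+B_i^\top S^i_{k+1}B_i)^{-1}B_i^\top S^i_{k+1})A_i$, $S^i_T=\Lambda_i$; $L^i_k=(R_i+B_i^\top S^i_{k+1}B_i)^{-1}B_i^\top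 S^i_{k+1}A_i$; $\Gamma^i_k=(L^i_k)^\top(R_i+B_i^\top S^i_{k+1}B_i)L^i_k$. Scheduling policies are restricted to depend only on $\hat x^i_{0|-1}[1]$, innovations and preceding scheduling variables (so they are independent of the control policy). *)

(* Defs.v *)
From HB Require Import structures.
From mathcomp Require Import all_boot all_order all_algebra.
From mathcomp Require Import all_classical all_reals all_analysis.

Set Implicit Arguments.
Unset Strict Implicit.
Unset Printing Implicit Defensive.

Import Order.TTheory GRing.Theory Num.Theory.
Local Open Scope classical_set_scope.
Local Open Scope ring_scope.

Definition quad {R : comRingType} {n : nat} (M : 'M[R]_n) (x : 'cV[R]_n) : R :=
  (x^T *m M *m x) ord0 ord0.

Definition psd {R : realFieldType} {n : nat} (M : 'M[R]_n) : Prop :=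
  M^T = M /\ forall x : 'cV[R]_n, 0 <= quad M x.

Definition pd {R : realFieldType} {n : nat} (M : 'M[R]_n) : Prop :=
  M^T = M /\ forall x : 'cV[R]_n, x != 0 -> 0 < quad M x.

Fixpoint mxpow {R : pzRingType} {n : nat} (A : 'M[R]_n) (e : nat) : 'M[R]_n :=
  match e with 0 => 1%:M | e'.+1 => A *m mxpow A e' end.

Section LQ.
Variables (R : realType) (n m : nat).
Variables (A : 'M[R]_n) (B : 'M[R]_(n, m)).
Variables (Q : 'M[R]_n) (Rc : 'M[R]_m) (Lam : 'M[R]_n) (T : nat).

Definition ric_step (S : 'M[R]_n) : 'M[R]_n :=
  Q + A^T *m (S - S *m B *m invmx (Rc + B^T *m S *m B) *m B^T *m S) *m A.

(* backward iteration: Sbw t = S_{T-t} *)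
Fixpoint Sbw (t : nat) : 'M[R]_n :=
  match t with 0 => Lam | t'.+1 => ric_step (Sbw t') end.

Definition Sric (k : nat) : 'M[R]_n := Sbw (T - k).

(* L_k for k <= T-1; no control is applied at k >= T, so L_k := 0 there *)
Definition Lgain (k : nat) : 'M[R]_(m, n) :=
  if (k < T)%N then
    invmx (Rc + B^T *m Sric k.+1 *m B) *m B^T *m Sric k.+1 *m A
  else 0.

Definition Gam (k : nat) : 'M[R]_n :=
  (Lgain k)^T *m (Rc + B^T *m Sric k.+1 *m B) *m Lgain k.

End LQ.

Section Kalman.
Variables (R : realType) (n p : nat).
Variables (A : 'M[R]_n) (C : 'M[R]_(p, n)).
(* noise covariances W_k = Gw_k Gw_k^T, V_k = Gv_k Gv_k^T, Sigma_0 = G0 G0^T *)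
Variables (Gw : nat -> 'M[R]_n) (Gv : nat -> 'M[R]_p) (G0 : 'M[R]_n).

Definition Wc k := Gw k *m (Gw k)^T.
Definition Vc k := Gv k *m (Gv k)^T.

Definition kgain_of (P : 'M[R]_n) (k : nat) : 'M[R]_(n, p) :=
  P *m C^T *m invmx (C *m P *m C^T + Vc k).

Fixpoint Pprior (k : nat) : 'M[R]_n :=
  match k with
  | 0 => G0 *m G0^T
  | k'.+1 => let P := Pprior k' in
             A *m ((1%:M - kgain_of P k' *m C) *m P) *m A^T + Wc k'
  end.

Definition Kg (k : nat) : 'M[R]_(n, p) := kgain_of (Pprior k) k.

End Kalman.

(* indices of the i.i.d. standard normal scalars generating x_0, w_k, v_k *)
Definition nidx : Type := (nat + (nat * nat) + (nat * nat))%type.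
Definition I0 (i : nat) : nidx := inl (inl i).          (* component of x_0 *)
Definition IW (k i : nat) : nidx := inl (inr (k, i)).   (* time, component of w_k *)
Definition IV (k i : nat) : nidx := inr (k, i).         (* time, component of v_k *)

Section Prob.
Variables (d : measure_display) (Omega : measurableType d) (R : realType).
Variable (P : probability Omega R).

Definition std_normal_family (g : nidx -> Omega -> R) : Prop :=
  forall i, measurable_fun setT (g i) /\
    forall B : set R, measurable B ->
      P (g i @^-1` B) = normal_prob 0 1 B.

Definition mutually_independent (g : nidx -> Omega -> R) : Prop :=
  forall (s : seq nidx) (B : nidx -> set R),
    uniq s -> (forall i, measurable (B i)) ->
    P (\bigcap_(i in [set` s]) (g i @^-1` B i)) =
    (\prod_(i <- s) P (g i @^-1` B i))%E.

End Prob.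

Section Loop.
Variables (d : measure_display) (Omega : measurableType d) (R : realType).
Variables (n m p L T : nat).
Variables (A : 'M[R]_n) (B : 'M[R]_(n, m)) (C : 'M[R]_(p, n)).
Variables (Q : 'M[R]_n) (Rc : 'M[R]_m) (Lam : 'M[R]_n).
Variables (Gw : nat -> 'M[R]_n) (Gv : nat -> 'M[R]_p) (G0 : 'M[R]_n).
Variable (g : nidx -> Omega -> R).

Definition x0 (w : Omega) : 'cV[R]_n := G0 *m \col_(i < n) g (I0 i) w.
Definition wn (k : nat) (w : Omega) : 'cV[R]_n :=
  Gw k *m \col_(i < n) g (IW k i) w.
Definition vn (k : nat) (w : Omega) : 'cV[R]_p :=
  Gv k *m \col_(i < p) g (IV k i) w.

Definition Kk := Kg A C Gw Gv G0.
Definition Lk := Lgain A B Q Rc Lam T.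

(* A scheduling rule: delta_k[j] as a function of k, the current
   estimates xhat_{k|k}[.] (indexed by j = 1..L+1) and the hop j. *)
Definition rule := nat -> (nat -> 'cV[R]_n) -> nat -> bool.

Definition ctrl (k : nat) (xh : nat -> 'cV[R]_n) : 'cV[R]_m :=
  - (Lk k *m xh L.+1).

(* closed loop: (x_k, j |-> xhat_{k|k}[j]) *)
Fixpoint cl (pi : rule) (k : nat) (w : Omega) : 'cV[R]_n * (nat -> 'cV[R]_n) :=
  match k with
  | 0 =>
    let x := x0 w in
    let y := C *m x + vn 0 w in
    let z := Kk 0 *m y in      (* prior xhat_{0|-1} = 0 (zero-mean x_0) *)
    (x, fun j => if j == 1%N then z else 0)
  | k'.+1 =>
    let: (x, xh) := cl pi k' w in
    let u := ctrl k' xh in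
    let x' := A *m x + B *m u + wn k' w in
    let y := C *m x' + vn k w in
    let pr := A *m xh 1%N + B *m u in
    let z := Kk k *m (y - C *m pr) in
    (x', fun j => if j == 1%N then pr + z
                  else A *m (if pi k' xh j.-1 then xh j.-1 else xh j) + B *m u)
  end.

Definition state pi k w := (cl pi k w).1.
Definition est pi k w := (cl pi k w).2.
Definition input pi k w := ctrl k (est pi k w).
Definition delta pi k j w : bool := pi k (est pi k w) j.

Definition Jcost (P : probability Omega R) (pi : rule) : \bar R :=
  (\int[P]_w (quad Lam (state pi T w)
      + \sum_(k < T) (quad Q (state pi k w) + quad Rc (input pi k w)))%:E)%E.

Definition Ecount (P : probability Omega R) (pi : rule) (j : nat) : \bar R :=
  (\int[P]_w (\sum_(k < T) ((delta pi k j w : nat)%:R : R))%:E)%E.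

Definition Lagr (P : probability Omega R) (lam : nat -> R) (pi : rule) : \bar R :=
  (Jcost P pi + \sum_(1 <= j < L.+1) (lam j)%:E * Ecount P pi j)%E.

Definition periodic_policy : rule := fun k _ _ => (k <= T.-1)%N.

Definition dVoI (lam : nat -> R) (k : nat) (xh : nat -> 'cV[R]_n) (j : nat) : R :=
  let e := (L.+1 - j)%N in
  lam j - quad ((mxpow A e)^T *m Gam A B Q Rc Lam T (k + e) *m mxpow A e)
               (xh j - xh j.+1).

Definition dvoi_policy (lam : nat -> R) : rule :=
  fun k xh j => ((k + (L.+1 - j) <= T)%N && (dVoI lam k xh j < 0)).

End Loop.

(* Main.v *)
(** Completing the square along the Riccati recursion shows that the control cost
of any policy is a policy-free constant plus the sum over k of
E[|x_k - xhat_k[L+1]|^2_{Gamma_k}].  Split x_k - xhat_k[L+1] into the Kalman error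
and the mismatches xhat_k[j] - xhat_k[j+1].  The Kalman error is independent of the
innovations, and every innovation sits in exactly one mismatch, being moved one
hop further by each transmission.  When the decisions are even functions of the
mismatches, flipping the signs of the innovations sitting in one mismatch
preserves both the law and all the decisions; hence the cross terms vanish, and the
cost becomes a policy-free constant plus, for every (k, j) with k + L + 1 - j < T,
the expectation of the quadratic form of dVoI_k[j] over the event that hop j does
not transmit at time k.  Adding the communication price lambda[j] per transmission,
the dVoI rule pays at most lambda[j] for each (k, j), and the periodic rule pays
at least that.

Independence is only used through invariance of the standard Gaussian measure under
orthogonal reflections, obtained from plane rotations (products of shears); since
all quadratic forms are positive semidefinite, no integrability is needed. *)
Require Import Defs.
From HB Require Import structures.
From mathcomp Require Import all_boot all_order all_algebra.
From mathcomp Require Import all_classical all_reals all_analysis.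
From mathcomp Require Import measurable_realfun ring lra.
Set Implicit Arguments.
Unset Strict Implicit.
Unset Printing Implicit Defensive.
Import Order.TTheory GRing.Theory Num.Theory.
Local Open Scope classical_set_scope.
Local Open Scope ring_scope.

(** * Gaussian measure on the plane *)

Definition measure_preserving (d : measure_display) (X : measurableType d)
    (R : realType) (mu : set X -> \bar R) (f : X -> X) : Prop :=
  measurable_fun setT f /\
  forall S, measurable S -> mu (f @^-1` S) = mu S.

Section measure_preserving.
Context d (X : measurableType d) (R : realType).
Variable mu : {measure set X -> \bar R}.

Lemma measure_preserving_comp (f h : X -> X) :
  measure_preserving mu f -> measure_preserving mu h ->
  measure_preserving mu (f \o h).
Proof.
move=> [mf fE] [mh hE]; split; first exact: measurableT_comp.
move=> S mS; rewrite comp_preimage hE ?fE// -[X in measurable X]setTI.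
exact: mf.
Qed.

Lemma measure_preserving_id : measure_preserving mu id.
Proof. by split. Qed.

Lemma measure_preserving_integral (f : X -> X) (S : set X) (h : X -> \bar R) :
  measure_preserving mu f -> measurable S -> measurable_fun S h ->
  (forall x, (0 <= h x)%E) ->
  (\int[mu]_(x in f @^-1` S) h (f x) = \int[mu]_(x in S) h x)%E.
Proof.
move=> [mf fE] mS mh h0.
transitivity (\int[pushforward mu f]_(x in S) h x)%E.
  by rewrite (ge0_integral_pushforward mf).
by apply: eq_measure_integral => A mA _; exact: fE.
Qed.

End measure_preserving.

Section plane.
Variable R : realType.
Let RT := measurableTypeR R.
Let leb : {sigma_finite_measure set RT -> \bar R} := @lebesgue_measure R.
Let leb2 := (leb \x leb)%E.

(** The translated measure gives intervals their length, and this determines Lebesgue measure. *)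
Lemma lebesgue_measure_translate (a : R) (A : set RT) : measurable A ->
  lebesgue_measure ((fun y : RT => y + a : RT) @^-1` A) = lebesgue_measure A.
Proof.
have mT : measurable_fun setT (fun y : RT => y + a : RT).
  exact: measurable_funD.
move=> mA; apply/esym; apply: (@lebesgue_measure_unique _
  (pushforward (@lebesgue_measure R) (fun y : RT => y + a : RT))) => //.
move=> _ [[b c] _ <-].
rewrite [RHS](_ : _ = lebesgue_measure `]b - a, c - a]%classic); last first.
  congr lebesgue_measure.
  by apply/seteqP; split=> y /=; rewrite !in_itv/= ltrBlDr lerBrDr.
rewrite !lebesgue_measure_itv/= !lte_fin ltrD2r.
case: ifP => // _; rewrite -!EFinB; congr (_%:E); ring.
Qed.

Lemma lebesgue2_swap :
  measure_preserving leb2 (fun z : RT * RT => (z.2, z.1) : RT * RT).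
Proof.
have mswap : measurable_fun setT (fun z : RT * RT => (z.2, z.1) : RT * RT).
  exact: measurable_swap.
split=> // S mS.
apply/esym; apply: (product_measure_unique
  (m' := pushforward leb2 (fun z : RT * RT => (z.2, z.1) : RT * RT))) => //.
move=> A B mA mB; rewrite /pushforward.
rewrite [LHS](_ : _ = leb2 (B `*` A)); last first.
  by congr (leb2 _); apply/seteqP; split=> -[x y] /= [].
by rewrite /leb2 product_measure1E// muleC.
Qed.

(** On the vertical line through [x] the shear is the translation by [t * x], so every section keeps
    its length. *)
Lemma lebesgue2_shear2 (t : R) :
  measure_preserving leb2 (fun z : RT * RT => (z.1, z.2 + t * z.1) : RT * RT).
Proof.
split.
  apply: measurable_fun_pair => //=; apply: measurable_funD => //.
  exact: measurable_funM.
move=> S mS; rewrite /leb2 /product_measure1; apply: eq_integral => x _ /=.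
rewrite -[RHS](lebesgue_measure_translate (t * x)); last exact: measurable_xsection.
by congr (lebesgue_measure _); apply/seteqP; split=> y /=;
   rewrite /xsection /= !inE.
Qed.

(** This is the other shear conjugated by the swap of coordinates. *)
Lemma lebesgue2_shear1 (t : R) :
  measure_preserving leb2 (fun z : RT * RT => (z.1 + t * z.2, z.2) : RT * RT).
Proof.
have h := measure_preserving_comp lebesgue2_swap
  (measure_preserving_comp (lebesgue2_shear2 t) lebesgue2_swap).
by apply: eq_ind h _ _; apply/funext => -[x y].
Qed.

(* A rotation of angle other than pi is the product of three shears of
   parameters - tan (theta / 2), sin theta and - tan (theta / 2). *)
Lemma lebesgue2_rotation (c s : R) : c ^+ 2 + s ^+ 2 = 1 -> c != -1 ->
  measure_preserving leb2
    (fun z : RT * RT => (c * z.1 - s * z.2, s * z.1 + c * z.2) : RT * RT).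
Proof.
move=> cs c1; pose t := - (s / (1 + c)).
have c0 : 1 + c != 0 by rewrite addrC addr_eq0.
have h := measure_preserving_comp (lebesgue2_shear1 t)
  (measure_preserving_comp (lebesgue2_shear2 s) (lebesgue2_shear1 t)).
apply: eq_ind h _ _; apply/funext => -[x y]/=; rewrite /t.
have s2 : s ^+ 2 = (1 - c) * (1 + c) by move: cs; rewrite !expr2; lra.
(* With [u = s / (1 + c)] the half-angle tangent, the product of shears uses only [s * u = 1 - c]
   and [u * c = s - u]. *)
have st : s * (s / (1 + c)) = 1 - c by rewrite mulrA -expr2 s2 mulfK.
have tt : (s / (1 + c)) * c = s - (s / (1 + c)) by field.
move: (s / (1 + c)) st tt => u su uc.
have E1 (a b : R) :
    a + - u * b + - u * (b + s * (a + - u * b)) = c * a - s * b.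
  rewrite [LHS](_ : _ = a * (1 - s * u) - b * (u + u * (1 - s * u))); last by ring.
  by rewrite su subKr uc; ring.
have E2 (a b : R) : b + s * (a + - u * b) = s * a + c * b.
  rewrite [LHS](_ : _ = s * a + b * (1 - s * u)); last by ring.
  by rewrite su; ring.
by congr pair; [exact: E1|exact: E2].
Qed.

(** The planar Gaussian measure in density form, on which a change of variables for Lebesgue measure
    can act. *)
Definition gauss2 (S : set (RT * RT)) : \bar R :=
  (\int[leb2]_(z in S) (normal_pdf 0 1 z.1 * normal_pdf 0 1 z.2)%:E)%E.

Let gauss_dens0 (z : RT * RT) :
  (0 <= (normal_pdf 0 1 z.1 * normal_pdf 0 1 z.2 : R)%:E)%E.
Proof. by rewrite lee_fin mulr_ge0// normal_pdf_ge0. Qed.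

Let measurable_gauss_dens (D : set (RT * RT)) : measurable_fun D
  (fun z : RT * RT => (normal_pdf 0 1 z.1 * normal_pdf 0 1 z.2 : R)%:E).
Proof.
apply: measurable_funTS; apply/measurable_EFinP; apply: measurable_funM => /=.
  by apply: measurableT_comp => //; exact: measurable_normal_pdf.
by apply: measurableT_comp => //; exact: measurable_normal_pdf.
Qed.

Let gauss20 : gauss2 set0 = 0%E. Proof. exact: integral_set0. Qed.

Let gauss2_ge0 S : (0 <= gauss2 S)%E. Proof. exact: integral_ge0. Qed.

Let gauss2_sigma_additive : semi_sigma_additive gauss2.
Proof.
move=> F mF tF mUF; rewrite /gauss2 ge0_integral_bigcup//.
by apply: is_cvg_ereal_nneg_natsum_cond => n _ _; exact: gauss2_ge0.
Qed.

HB.instance Definition _ := isMeasure.Build _ _ _ gauss2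
  gauss20 gauss2_ge0 gauss2_sigma_additive.

(** A product measure is determined by rectangles; there the density factors and Tonelli separates
    the integrals. *)
Lemma gauss2E (S : set (RT * RT)) : measurable S ->
  (@normal_prob R 0 1 \x @normal_prob R 0 1)%E S = gauss2 S.
Proof.
move=> mS; apply: product_measure_unique => // A B mA mB /=.
rewrite /gauss2 integral_mkcond /=.
transitivity (\int[leb2]_z
  ((\1_A z.1 * normal_pdf 0 1 z.1)%:E * (\1_B z.2 * normal_pdf 0 1 z.2)%:E))%E.
  apply: eq_integral => -[x y] _; rewrite patchE -EFinM/=.
  rewrite !indicE; case: ifPn => [|].
    by rewrite inE => -[/= xA yB]; rewrite !mem_set//= !mul1r.
  rewrite notin_setE => nAB; case: (boolP (x \in A)) => xA /=; last by rewrite !mul0r.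
  case: (boolP (y \in B)) => yB; last by rewrite !(mul0r,mulr0).
  by case: nAB; split => /=; apply: set_mem.
have mi (C : set RT) : measurable C ->
    measurable_fun setT (fun x : RT => (\1_C x * normal_pdf 0 1 x : R)%:E).
  move=> mC; apply/measurable_EFinP; apply: measurable_funM => //.
  exact: measurable_normal_pdf.
have i0 (C : set RT) x : (0 <= (\1_C x * normal_pdf 0 1 x : R)%:E)%E.
  by rewrite lee_fin mulr_ge0// normal_pdf_ge0.
have ii (C : set RT) : measurable C ->
    (\int[leb]_x (\1_C x * normal_pdf 0 1 x : R)%:E = normal_prob 0 1 C)%E.
  move=> mC; rewrite /normal_prob [RHS]integral_mkcond; apply: eq_integral => x _.
  by rewrite patchE indicE; case: ifP => _; rewrite ?mul1r ?mul0r.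
rewrite fubini_tonelli1; first last.
- by move=> z; rewrite mule_ge0.
- apply: emeasurable_funM.
    exact: (measurableT_comp (mi _ mA) measurable_fst).
  exact: (measurableT_comp (mi _ mB) measurable_snd).
rewrite /fubini_F /=.
transitivity (\int[leb]_x
  ((\1_A x * normal_pdf 0 1 x)%:E * normal_prob 0 1 B))%E.
  by apply: eq_integral => x _; rewrite ge0_integralZl// ?ii//; exact: mi.
by rewrite ge0_integralZr// ?ii//; exact: mi.
Qed.

Lemma normal_pdf01E (x : R) :
  normal_pdf 0 1 x = normal_peak 1 * expR (- (x ^+ 2 / 2)) :> R.
Proof.
rewrite normal_pdfE ?oner_eq0//; congr (_ * expR _).
by rewrite subr0 expr1n mulNr.
Qed.

(** The density is a function of the squared norm alone, so it is unchanged along [f]. *)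
Lemma gauss2_preserving (f : RT * RT -> RT * RT) :
  measure_preserving leb2 f ->
  (forall z, (f z).1 ^+ 2 + (f z).2 ^+ 2 = z.1 ^+ 2 + z.2 ^+ 2 :> R) ->
  measure_preserving (@normal_prob R 0 1 \x @normal_prob R 0 1)%E f.
Proof.
move=> fP fE; split; first by case: fP.
move=> S mS; have [mf _] := fP.
have mfS : measurable (f @^-1` S) by rewrite -[X in measurable X]setTI; exact: mf.
rewrite !gauss2E// /gauss2 -(measure_preserving_integral fP mS)//.
apply: eq_integral => z _; congr (_%:E); rewrite !normal_pdf01E.
rewrite !(mulrACA _ (expR _)) -!expRD; congr (_ * expR _).
by rewrite -!opprD -!mulrDl fE.
Qed.

Lemma gauss2_rotation (c s : R) : c ^+ 2 + s ^+ 2 = 1 -> c != -1 ->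
  measure_preserving (@normal_prob R 0 1 \x @normal_prob R 0 1)%E
    (fun z : RT * RT => (c * z.1 - s * z.2, s * z.1 + c * z.2) : RT * RT).
Proof.
move=> cs c1; apply: gauss2_preserving; first exact: lebesgue2_rotation.
have E (x y : R) :
    (c * x - s * y) ^+ 2 + (s * x + c * y) ^+ 2 = x ^+ 2 + y ^+ 2.
  rewrite [LHS](_ : _ = (c ^+ 2 + s ^+ 2) * (x ^+ 2 + y ^+ 2)); last by ring.
  by rewrite cs mul1r.
by move=> -[x y] /=; exact: E.
Qed.

Lemma normal_prob_opp (A : set RT) : measurable A ->
  normal_prob 0 1 ((-%R : RT -> RT) @^-1` A) = normal_prob 0 1 A :> \bar R.
Proof.
have oP : measure_preserving leb (-%R : RT -> RT).
  by split=> // B mB; exact: lebesgue_measureN.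
move=> mA; rewrite /normal_prob -(measure_preserving_integral oP mA).
- by apply: eq_integral => x _; rewrite !normal_pdf01E sqrrN.
- by apply: measurable_funTS; apply/measurable_EFinP; exact: measurable_normal_pdf.
- by move=> x; rewrite lee_fin normal_pdf_ge0.
Qed.


End plane.

(** * Standard Gaussian measure on R^N *)

Definition gvec (R : realType) (N : nat) : Type := 'cV[R]_N.
HB.instance Definition _ (R : realType) N := Choice.on (gvec R N).
HB.instance Definition _ (R : realType) N := isPointed.Build (gvec R N) (0 : 'cV[R]_N).

Definition box (R : realType) (N : nat) (B : 'I_N -> set (measurableTypeR R)) :
  set (gvec R N) := [set x | forall i, B i ((x : 'cV[R]_N) i ord0)].

(** Boxes are stable under intersection and include the whole space, so finite measures that agree
    on them agree on the sigma-algebra they generate. *)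
Definition boxes (R : realType) (N : nat) : set (set (gvec R N)) :=
  [set S | exists2 B : 'I_N -> set (measurableTypeR R),
     forall i, measurable (B i) & S = box B].

Definition gspace (R : realType) (N : nat) := g_sigma_algebraType (@boxes R N).
HB.instance Definition _ (R : realType) N := Measurable.on (gspace R N).

Section gspace.
Variables (R : realType) (N : nat).
Let RT := measurableTypeR R.
Let X := gspace R N.
Implicit Type B : 'I_N -> set RT.

Lemma measurable_box B : (forall i, measurable (B i)) ->
  measurable (box B : set X).
Proof. by move=> mB; apply: sub_sigma_algebra; exists B. Qed.

Lemma measurable_coord (i : 'I_N) :
  measurable_fun setT (fun x : X => (x : 'cV[R]_N) i ord0 : RT).
Proof.
move=> _ S mS; rewrite setTI.
have -> : (fun x : X => (x : 'cV[R]_N) i ord0 : RT) @^-1` S =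
    box (fun k => if k == i then S else setT).
  apply/seteqP; split=> x /= => [Sx k|/(_ i)]; last by rewrite eqxx.
  by case: eqP => [->|].
by apply: measurable_box => k; case: ifP.
Qed.

Lemma measurable_gspace d (Y : measurableType d) (f : Y -> X) :
  (forall i, measurable_fun setT (fun y => (f y : 'cV[R]_N) i ord0 : RT)) ->
  measurable_fun setT f.
Proof.
move=> mf; apply: (@measurability _ _ Y X setT f (@boxes R N)) => //.
move=> _ [_ [B mB ->] <-]; rewrite setTI.
have -> : f @^-1` box B =
    \bigcap_(i in [set: 'I_N]) ((fun y => (f y : 'cV[R]_N) i ord0 : RT) @^-1` B i).
  by apply/seteqP; split=> y /= h i; [move=> _; exact: h|exact: h].
apply: fin_bigcap_measurable; first exact: finite_finset.
by move=> i _; rewrite -[X in measurable X]setTI; exact: mf.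
Qed.

(** A property rather than a constructed measure, so that the law of the noise vector can be used
    directly. *)
Definition std_gaussian (mu : set X -> \bar R) : Prop :=
  forall B, (forall i, measurable (B i)) ->
  mu (box B) = (\prod_(i < N) normal_prob 0 1 (B i))%E.

Variable mu : {measure set X -> \bar R}.
Hypothesis muG : std_gaussian mu.

Lemma std_gaussian_setT : mu setT = 1%E.
Proof.
have -> : [set: X] = box (fun _ : 'I_N => [set: RT]) by apply/seteqP; split.
by rewrite muG// big1// => i _; exact: probability_setT.
Qed.

Lemma preserving_boxes (f : X -> X) : measurable_fun setT f ->
  (forall B, (forall i, measurable (B i)) -> mu (f @^-1` box B) = mu (box B)) ->
  measure_preserving mu f.
Proof.
move=> mf fE; split=> // S mS.
apply/esym; apply: (@measure_unique _ R X (@boxes R N) (fun=> setT) _ _ _ _ mu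
  (pushforward mu f)) => //.
- move=> _ _ [B mB ->] [B' mB' ->]; exists (fun i => B i `&` B' i).
    by move=> i; exact: measurableI.
  by apply/seteqP; split=> x /= => [[h h'] i|h]; [split|split=> i; case: (h i)].
- by move=> _; exists (fun=> [set: RT]) => //; apply/seteqP; split.
- by rewrite bigcup_const//; exists 0%N.
- by move=> _ [B mB ->]; apply/esym; exact: fE.
- by move=> _; rewrite std_gaussian_setT ltry.
Qed.

Lemma preserving_ext (f h : X -> X) : measure_preserving mu f -> f =1 h ->
  measure_preserving mu h.
Proof. by move=> fP /funext <-. Qed.

Definition flip (i : 'I_N) (x : 'cV[R]_N) : 'cV[R]_N :=
  \col_k (if k == i then - x k ord0 else x k ord0).

Lemma flip_preserving i : measure_preserving mu (flip i : X -> X).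
Proof.
have mf : measurable_fun setT (flip i : X -> X).
  apply: measurable_gspace => k.
  apply: (eq_measurable_fun (fun x : X => if k == i then
     - (x : 'cV[R]_N) k ord0 : RT else (x : 'cV[R]_N) k ord0 : RT)).
    by move=> x _; rewrite mxE.
  case: (k == i); last exact: measurable_coord.
  by apply: measurableT_comp => //; exact: measurable_coord.
apply: preserving_boxes => // B mB.
have -> : (flip i : X -> X) @^-1` box B =
    box (fun k => if k == i then (-%R : RT -> RT) @^-1` B k else B k).
  by apply/seteqP; split=> x /= h k; have := h k; rewrite mxE; case: ifP.
rewrite !muG//.
  by apply: eq_bigr => k _; case: ifP => // _; exact: normal_prob_opp.
move=> k; case: ifP => // _; rewrite -[X in measurable X]setTI.
by have : measurable_fun setT (-%R : RT -> RT) by []; exact.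
Qed.

Definition givens (i j : 'I_N) (c s : R) (x : 'cV[R]_N) : 'cV[R]_N :=
  \col_k (if k == i then c * x i ord0 - s * x j ord0
          else if k == j then s * x i ord0 + c * x j ord0 else x k ord0).

(** Boxes suffice. The constraints on the coordinates other than [i] and [j] are kept as an event;
    on it the pair of coordinates [i], [j] has the planar Gaussian law times a constant, and the
    planar rotation applies. *)
Lemma givens_preserving i j (c s : R) : i != j -> c ^+ 2 + s ^+ 2 = 1 ->
  c != -1 -> measure_preserving mu (givens i j c s : X -> X).
Proof.
move=> ij cs c1.
have mf : measurable_fun setT (givens i j c s : X -> X).
  apply: measurable_gspace => k.
  apply: (eq_measurable_fun (fun x : X => if k == i then
     c * (x : 'cV[R]_N) i ord0 - s * (x : 'cV[R]_N) j ord0 : RT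
     else if k == j then s * (x : 'cV[R]_N) i ord0 + c * (x : 'cV[R]_N) j ord0 : RT
     else (x : 'cV[R]_N) k ord0 : RT)).
    by move=> x _; rewrite mxE.
  case: (k == i); first by apply: measurable_funB; apply: measurable_funM => //;
    exact: measurable_coord.
  case: (k == j); last exact: measurable_coord.
  by apply: measurable_funD; apply: measurable_funM => //; exact: measurable_coord.
apply: preserving_boxes => // B mB.
pose Bij (A A' : set RT) k := if k == i then A else if k == j then A' else B k.
have mBij A A' : measurable A -> measurable A' -> forall k, measurable (Bij A A' k).
  by move=> mA mA' k; rewrite /Bij; case: ifP => // _; case: ifP.
pose D : set X := box (Bij setT setT).
have mD : measurable D by apply: measurable_box; exact: mBij.
pose pr (x : X) : RT * RT := ((x : 'cV[R]_N) i ord0, (x : 'cV[R]_N) j ord0).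
have mpr : measurable_fun setT pr.
  by apply: measurable_fun_pair; exact: measurable_coord.
have prod_fin (P : pred 'I_N) (F : 'I_N -> set RT) : (forall k, measurable (F k)) ->
    exists r : {nonneg R}, (\prod_(k | P k) normal_prob 0 1 (F k))%E = r%:num%:E.
  move=> mF; elim/big_rec: _ => [|k y _ [r ->]]; first by exists 1%:nng.
  have fk : (normal_prob 0 1 (F k) : \bar R) \is a fin_num by apply: fin_num_measure; exact: mF.
  have kr : 0 <= fine (normal_prob 0 1 (F k) : \bar R) * r%:num.
    by rewrite mulr_ge0 ?fine_ge0.
  by exists (NngNum kr); rewrite /= EFinM fineK.
have [r rE] := prod_fin (fun k => (k != i) && (k != j)) _ mB.
(* The constant [r], the mass of the remaining factors, is put into the first marginal so that
   uniqueness of product measures applies. *)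
pose m1 : {sigma_finite_measure set RT -> \bar R} := mscale r (@normal_prob R 0 1).
pose pm : {measure set (RT * RT) -> \bar R} := pushforward (mrestr mu mD) pr.
pose m' := pm mpr.
have DE A A' : measurable A -> measurable A' ->
    m' (A `*` A') = mu (box (Bij A A')).
  move=> mA mA'; apply: (congr1 mu).
  apply/seteqP; split=> x /=.
    move=> [[Ax Ax'] Dx] k; have := Dx k; rewrite /Bij.
    by case: eqP => [->|_]//; case: eqP => [->|].
  move=> h; split; last first.
    by move=> k; have := h k; rewrite /Bij; case: eqP => // _; case: eqP.
  have := h i; have := h j; rewrite /Bij !eqxx eq_sym (negbTE ij).
  by split.
have boxE A A' : measurable A -> measurable A' ->
    mu (box (Bij A A')) = (normal_prob 0 1 A * (normal_prob 0 1 A' * r%:num%:E))%E.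
  move=> mA mA'; rewrite muG; last exact: mBij.
  rewrite (bigD1 i)//= (bigD1 j)/=; last by rewrite eq_sym.
  rewrite /Bij !eqxx eq_sym (negbTE ij) -rE; congr (_ * (_ * _))%E.
  by apply: eq_bigr => k /andP[/negbTE -> /negbTE ->].
have m'E (S : set (RT * RT)) : measurable S ->
    m' S = (r%:num%:E * (@normal_prob R 0 1 \x @normal_prob R 0 1) S)%E.
  move=> mS.
  rewrite -(product_measure_unique (m1 := m1) (m2 := @normal_prob R 0 1) (m' := m'))//.
    rewrite /product_measure1 /= ge0_integral_mscale//.
    exact: measurable_fun_xsection.
  move=> A A' mA mA'; rewrite DE// boxE// /m1 /= /mscale/=.
  by rewrite muleA muleC muleA.
pose rot (z : RT * RT) : RT * RT := (c * z.1 - s * z.2, s * z.1 + c * z.2).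
have [mrot rotE] := gauss2_rotation cs c1.
have BE : box B = box (Bij (B i) (B j)).
  congr box; apply/funext => k; rewrite /Bij.
  by case: eqP => [->|]// _; case: eqP => [->|].
have -> : mu (givens i j c s @^-1` box B) = m' (rot @^-1` (B i `*` B j)).
  apply: (congr1 mu).
  apply/seteqP; split=> x /=.
    move=> h; split; last first.
      move=> k; have := h k; rewrite mxE /Bij.
      by case: eqP => // _; case: eqP.
    have := h i; have := h j; rewrite !mxE !eqxx eq_sym (negbTE ij).
    by split.
  move=> [[/= hi hj] Dx] k; have := Dx k; rewrite mxE /Bij.
  by case: eqP => [->|_]//; case: eqP => [->|].
have mBB : measurable (B i `*` B j) by exact: measurableX.
rewrite m'E; last by rewrite -[X in measurable X]setTI; exact: mrot.
by rewrite (rotE _ mBB) -m'E// DE// -BE.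
Qed.

End gspace.

(** * Invariance under reflections *)

Section reflections.
Variables (R : realType) (N : nat).

Definition dot (x y : 'cV[R]_N) : R := \sum_k x k ord0 * y k ord0.

Lemma dotE (x y : 'cV[R]_N) : x^T *m y = (dot x y)%:M.
Proof.
rewrite [LHS]mx11_scalar; congr (_%:M); rewrite mxE.
by apply: eq_bigr => k _; rewrite mxE.
Qed.

Lemma row_dotE (f : 'rV[R]_N) (y : 'cV[R]_N) : f *m y = (dot f^T y)%:M.
Proof. by rewrite -dotE trmxK. Qed.

Lemma dot_eq0 (x : 'cV[R]_N) : dot x x = 0 -> x = 0.
Proof.
move=> /eqP; rewrite psumr_eq0; last by move=> k _; rewrite -expr2 sqr_ge0.
move=> /allP h; apply/matrixP => k l; rewrite ord1 mxE; apply/eqP.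
by have := h k (mem_index_enum k); rewrite /= mulf_eq0 orbb.
Qed.

(** The Householder reflection along [a]; for [a = 0] it is the identity. *)
Definition hh (a x : 'cV[R]_N) : 'cV[R]_N := x - (2 * dot a x / dot a a) *: a.

Lemma givens_dot i j (c s : R) (x y : 'cV[R]_N) : i != j ->
  c ^+ 2 + s ^+ 2 = 1 ->
  dot (givens i j c s x) (givens i j c s y) = dot x y.
Proof.
move=> ij cs; rewrite /dot.
rewrite (bigD1 i)//= (bigD1 j)/=; last by rewrite eq_sym.
rewrite [RHS](bigD1 i)//= [in RHS](bigD1 j)/=; last by rewrite eq_sym.
rewrite !addrA; congr (_ + _); last first.
  by apply: eq_bigr => k /andP[/negbTE ki /negbTE kj]; rewrite !mxE ki kj.
rewrite !mxE !eqxx eq_sym (negbTE ij).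
rewrite [LHS](_ : _ = (c ^+ 2 + s ^+ 2) * (x i ord0 * y i ord0 + x j ord0 * y j ord0));
  last by ring.
by rewrite cs mul1r.
Qed.

Lemma givensK i j (c s : R) (x : 'cV[R]_N) : i != j -> c ^+ 2 + s ^+ 2 = 1 ->
  givens i j c (- s) (givens i j c s x) = x.
Proof.
have -> : (i != j) = (j != i) by rewrite eq_sym.
move=> /negbTE ji cs; apply/matrixP => k l; rewrite ord1 !mxE !eqxx ji.
case: eqP => [->|ki].
  rewrite [LHS](_ : _ = (c ^+ 2 + s ^+ 2) * x i ord0); last by ring.
  by rewrite cs mul1r.
case: eqP => [->|kj]//.
rewrite [LHS](_ : _ = (c ^+ 2 + s ^+ 2) * x j ord0); last by ring.
by rewrite cs mul1r.
Qed.

Lemma givensBZ i j (c s t : R) (x y : 'cV[R]_N) :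
  givens i j c s (x - t *: y) = givens i j c s x - t *: givens i j c s y.
Proof.
by apply/matrixP => k l; rewrite ord1 !mxE; case: (k == i); [ring|case: (k == j); ring].
Qed.

(** A rotation is an isometry, so it carries the reflection along [a] to the one along the rotated
    vector. *)
Lemma hh_givens i j (c s : R) (a x : 'cV[R]_N) : i != j ->
  c ^+ 2 + s ^+ 2 = 1 ->
  hh a x = givens i j c (- s) (hh (givens i j c s a) (givens i j c s x)).
Proof.
by move=> ij cs; rewrite /hh givensBZ !givensK// !givens_dot.
Qed.

Variable mu : {measure set (gspace R N) -> \bar R}.
Hypothesis muG : std_gaussian mu.

(* A Givens rotation conjugates the reflection along a vector to the reflection
   along a vector with smaller support. *)
Lemma hh_preserving (a : 'cV[R]_N) :
  measure_preserving mu (hh a : gspace R N -> gspace R N).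
Proof.
have [m] := ubnP #|[set k | a k ord0 != 0]%SET|.
elim: m a => // m IH a am.
have [/existsP[i ai]|a0] := boolP [exists i, a i ord0 != 0];
    last first.
  apply: (preserving_ext (measure_preserving_id mu)) => x.
  suff -> : a = 0 by rewrite /hh scaler0 subr0.
  apply/matrixP => k l; rewrite ord1 mxE; apply/eqP/negPn.
  by apply: contraNN a0 => ak; apply/existsP; exists k.
have [/existsP[j /andP[ji aj]]|nj] := boolP [exists j, (j != i) && (a j ord0 != 0)];
    last first.
  have a0 k : k != i -> a k ord0 = 0.
    move=> ki; apply/eqP/negPn/negP => ak; move/existsP: nj; apply.
    by exists k; rewrite ki.
  have dE y : dot a y = a i ord0 * y i ord0.
    by rewrite /dot (bigD1 i)//= big1 ?addr0// => k /a0 ->; rewrite mul0r.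
  (* Along a coordinate axis the reflection only changes the sign of one coordinate. *)
  apply: (preserving_ext (flip_preserving muG i)) => x.
  apply/matrixP => k l; rewrite ord1 /hh !mxE !dE.
  by have [->|/a0 ->] := eqVneq k i; [field|rewrite mulr0 subr0].
(* The rotation is chosen to send [(a i, a j)] to [(r, 0)], so that [j] leaves the support. *)
pose r := Num.sqrt (a i ord0 ^+ 2 + a j ord0 ^+ 2).
have r2 : r ^+ 2 = a i ord0 ^+ 2 + a j ord0 ^+ 2.
  by rewrite sqr_sqrtr// addr_ge0// sqr_ge0.
have r0 : r != 0.
  apply: contraNneq aj => r0; move: r2; rewrite r0 expr0n => /esym/eqP.
  by rewrite paddr_eq0 ?sqr_ge0// !sqrf_eq0 => /andP[].
pose c := a i ord0 / r; pose s := - (a j ord0 / r).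
have cs : c ^+ 2 + s ^+ 2 = 1.
  by rewrite /c /s sqrrN !expr_div_n -mulrDl -r2 divff// sqrf_eq0.
have s0 : s != 0 by rewrite /s oppr_eq0 mulf_neq0// invr_eq0.
(* The excluded angle would give [s = 0], hence [a j = 0]. *)
have c1 : c != -1.
  apply: contra_neq s0 => cE; apply/eqP; rewrite -sqrf_eq0; apply/eqP.
  by move: cs; rewrite cE sqrrN expr1n; lra.
have ij : i != j by rewrite eq_sym.
have csN : c ^+ 2 + (- s) ^+ 2 = 1 by rewrite sqrrN.
apply: (@preserving_ext _ _ _ ((givens i j c (- s) : gspace R N -> gspace R N) \o
   ((hh (givens i j c s a) : gspace R N -> gspace R N) \o
    (givens i j c s : gspace R N -> gspace R N)))); last first.
  by move=> x /=; rewrite -hh_givens.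
apply: measure_preserving_comp; first exact: givens_preserving.
apply: measure_preserving_comp; last exact: givens_preserving.
apply: IH; rewrite -ltnS; apply: leq_trans am; rewrite ltnS.
apply: proper_card; apply/properP; split; last first.
  exists j; rewrite inE// mxE (negbTE ji) eqxx negbK.
  by apply/eqP; rewrite /c /s; field.
apply/fintype.subsetP => k; rewrite !inE mxE.
by have [->|_] := eqVneq k i; [|have [->|] := eqVneq k j].
Qed.

Definition preserves (U : 'M[R]_N) : Prop :=
  measure_preserving mu ((fun x : 'cV[R]_N => U *m x) : gspace R N -> gspace R N).

Lemma preserves1 : preserves 1%:M.
Proof.
by apply: (preserving_ext (measure_preserving_id mu)) => x; rewrite mul1mx.
Qed.

Lemma preservesM (U V : 'M[R]_N) : preserves U -> preserves V ->
  preserves (U *m V).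
Proof.
move=> hU hV; apply: (preserving_ext (measure_preserving_comp hU hV)) => x /=.
by rewrite mulmxA.
Qed.

(** The matrix of [hh], indexed by a row because reflections will act on the right of coefficient
    matrices. *)
Definition hhmx (f : 'rV[R]_N) : 'M[R]_N :=
  1%:M - (2 / dot f^T f^T) *: (f^T *m f).

Lemma hhmx_preserves f : preserves (hhmx f).
Proof.
apply: (preserving_ext (hh_preserving f^T)) => x; rewrite /hhmx /hh.
rewrite mulmxBl mul1mx -scalemxAl -mulmxA row_dotE mul_mx_scalar.
by rewrite scalerA; congr (_ - _ *: _); rewrite mulrAC.
Qed.

Lemma hhmx_neg f : f *m hhmx f = - f.
Proof.
rewrite /hhmx mulmxBr mulmx1 -scalemxAr mulmxA row_dotE mul_scalar_mx.
rewrite scalerA; have [/dot_eq0|f0] := eqVneq (dot f^T f^T) 0.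
  by move=> /(congr1 trmx); rewrite trmxK trmx0 => ->; rewrite scaler0 subr0 oppr0.
by rewrite divfK// scaler_nat mulr2n opprD addNKr.
Qed.

Lemma hhmx_fix f q (H : 'M[R]_(q, N)) : H *m f^T = 0 -> H *m hhmx f = H.
Proof.
by move=> Hf; rewrite /hhmx mulmxBr mulmx1 -scalemxAr mulmxA Hf mul0mx scaler0 subr0.
Qed.

(* Gram-Schmidt: the reflection through the orthogonal complement of the row
   space of [F] is a product of reflections along vectors. *)
Lemma reflection_ex r (F : 'M[R]_(r, N)) : exists U,
  [/\ preserves U, F *m U = - F &
      forall q (H : 'M[R]_(q, N)), H *m F^T = 0 -> H *m U = H].
Proof.
elim: r F => [|r IH].
  move=> F; exists 1%:M; split; first exact: preserves1.
    by apply/matrixP => -[].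
  by move=> q H _; rewrite mulmx1.
rewrite -[r.+1]/(1 + r)%N => F.
pose f : 'rV_N := usubmx F; pose F2 := dsubmx F.
(* Projection coefficients of the rows of [F2] on [f]; if [f = 0] the inverse is 0 and so is [v]. *)
pose v := (dot f^T f^T)^-1 *: (F2 *m f^T).
have FE : F = col_mx f F2 by rewrite vsubmxK.
pose F' := F2 - v *m f.
have F'f : F' *m f^T = 0.
  rewrite /F' mulmxBl -mulmxA row_dotE mul_mx_scalar scalerA.
  have [/dot_eq0 f0|f0] := eqVneq (dot f^T f^T) 0.
    by rewrite f0 !mulmx0 scaler0 subr0.
  by rewrite divff// scale1r subrr.
have [U [Upres UF' Ufix]] := IH F'.
have fU : f *m U = f by apply: Ufix; rewrite -[LHS]trmxK trmx_mul trmxK F'f trmx0.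
have F2E : F2 = F' + v *m f by rewrite subrK.
(* [hhmx f] negates [f] and fixes [F']; [U] negates [F'] and fixes [f]. So the product negates both,
   hence also [F2 = F' + v *m f]. *)
exists (hhmx f *m U); split.
- by apply: preservesM => //; exact: hhmx_preserves.
- rewrite FE mul_col_mx opp_col_mx; congr col_mx.
    by rewrite mulmxA hhmx_neg mulNmx fU.
  rewrite mulmxA {1}F2E mulmxDl (hhmx_fix F'f) -mulmxA hhmx_neg mulmxN.
  by rewrite mulmxDl mulNmx UF' -mulmxA fU -opprD -F2E.
- move=> q H; rewrite FE tr_col_mx mul_mx_row => HF.
  have Hf : H *m f^T = 0.
    by have /(congr1 lsubmx) := HF; rewrite row_mxKl linear0.
  have HF2 : H *m F2^T = 0.
    by have /(congr1 rsubmx) := HF; rewrite row_mxKr linear0.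
  rewrite mulmxA hhmx_fix//; apply: Ufix.
  by rewrite /F' linearB /= mulmxBr HF2 trmx_mul mulmxA Hf mul0mx subrr.
Qed.

End reflections.

(** * Expectations of quadratic forms *)

Section quadratic_forms.
Variable R : realType.
Implicit Type n : nat.

Lemma quadE n (M : 'M[R]_n) x : quad M x = \sum_i \sum_j x j ord0 * M j i * x i ord0.
Proof.
rewrite /quad mxE; apply: eq_bigr => i _; rewrite mxE mulr_suml.
by apply: eq_bigr => j _; rewrite mxE.
Qed.

Lemma quadN n (M : 'M[R]_n) x : quad M (- x) = quad M x.
Proof.
have -> : - x = (- 1%:M) *m x by rewrite mulNmx mul1mx.
by rewrite /quad trmx_mul linearN /= trmx1 !(mulNmx, mulmxN) opprK mulmx1 mul1mx.
Qed.

Lemma quad0 n (M : 'M[R]_n) : quad M 0 = 0.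
Proof. by rewrite /quad mulmx0 mxE. Qed.

Lemma quad_mul n p (M : 'M[R]_n) (A : 'M[R]_(n, p)) x :
  quad M (A *m x) = quad (A^T *m M *m A) x.
Proof. by rewrite /quad trmx_mul !mulmxA. Qed.

Lemma quad_addl n (M M' : 'M[R]_n) x : quad (M + M') x = quad M x + quad M' x.
Proof. by rewrite /quad mulmxDr mulmxDl mxE. Qed.

Lemma quad_subl n (M M' : 'M[R]_n) x : quad (M - M') x = quad M x - quad M' x.
Proof. by rewrite /quad mulmxBr mulmxBl !mxE. Qed.

Lemma quad_parallelogram n (M : 'M[R]_n) a b :
  quad M (a + b) + quad M (a - b) = (quad M a + quad M b) + (quad M a + quad M b).
Proof.
rewrite !quadE -!big_split /=; apply: eq_bigr => i _.
by rewrite -!big_split /=; apply: eq_bigr => j _; rewrite !mxE; ring.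
Qed.

Lemma psd_mul n p (M : 'M[R]_n) (A : 'M[R]_(n, p)) : psd M -> psd (A^T *m M *m A).
Proof.
move=> [Ms M0]; split; first by rewrite !trmx_mul trmxK Ms mulmxA.
by move=> x; rewrite -quad_mul.
Qed.

End quadratic_forms.

Section expectations.
Context d (Y : measurableType d) (R : realType).
Variable mu : {measure set Y -> \bar R}.
Implicit Type n : nat.

Definition mvec n (f : Y -> 'cV[R]_n) : Prop :=
  forall i, measurable_fun setT (fun y => f y i ord0).

Lemma mvec_cst n (c : 'cV[R]_n) : mvec (fun=> c).
Proof. by move=> i; exact: measurable_cst. Qed.

Lemma mvecD n (f h : Y -> 'cV[R]_n) : mvec f -> mvec h -> mvec (fun y => f y + h y).
Proof.
move=> mf mh i; apply: (eq_measurable_fun (fun y => f y i ord0 + h y i ord0)).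
  by move=> y _; rewrite mxE.
exact: measurable_funD.
Qed.

Lemma mvec_mul n p (M : 'M[R]_(p, n)) (f : Y -> 'cV[R]_n) :
  mvec f -> mvec (fun y => M *m f y).
Proof.
move=> mf i; apply: (eq_measurable_fun (fun y => \sum_j M i j * f y j ord0)).
  by move=> y _; rewrite mxE.
by apply: measurable_sum => j; apply: measurable_funM.
Qed.

Lemma mvecN n (f : Y -> 'cV[R]_n) : mvec f -> mvec (fun y => - f y).
Proof.
move=> /(mvec_mul (- 1%:M)); congr mvec; apply/funext => y.
by rewrite mulNmx mul1mx.
Qed.

Lemma mvecB n (f h : Y -> 'cV[R]_n) : mvec f -> mvec h -> mvec (fun y => f y - h y).
Proof. by move=> mf mh; apply: mvecD => //; exact: mvecN. Qed.

Lemma mvec_sum n I (r : seq I) (P : pred I) (f : I -> Y -> 'cV[R]_n) :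
  (forall i, mvec (f i)) -> mvec (fun y => \sum_(i <- r | P i) f i y).
Proof.
move=> mf; elim: r => [|i r IH].
  by apply: eq_ind (mvec_cst 0) _ _; apply/funext => y; rewrite big_nil.
case Pi : (P i).
  by apply: eq_ind (mvecD (mf i) IH) _ _; apply/funext => y; rewrite big_cons Pi.
by apply: eq_ind IH _ _; apply/funext => y; rewrite big_cons Pi.
Qed.

Lemma mvec_if n (b : Y -> bool) (f h : Y -> 'cV[R]_n) :
  measurable_fun setT b -> mvec f -> mvec h ->
  mvec (fun y => if b y then f y else h y).
Proof.
move=> mb mf mh i.
apply: (eq_measurable_fun (fun y => if b y then f y i ord0 else h y i ord0)).
  by move=> y _; case: ifP.
exact: measurable_fun_ifT.
Qed.

Lemma measurable_quad n (M : 'M[R]_n) (f : Y -> 'cV[R]_n) :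
  mvec f -> measurable_fun setT (fun y => quad M (f y)).
Proof.
move=> mf; apply: (eq_measurable_fun
  (fun y => \sum_i \sum_j f y j ord0 * M j i * f y i ord0)).
  by move=> y _; rewrite quadE.
apply: measurable_sum => i; apply: measurable_sum => j.
by apply: measurable_funM => //; apply: measurable_funM.
Qed.

Implicit Types (f h : Y -> R) (c : R).

Definition Ex (f : Y -> R) : \bar R := (\int[mu]_y (f y)%:E)%E.

Lemma Ex_ge0 f : (forall y, 0 <= f y) -> (0 <= Ex f)%E.
Proof. by move=> f0; apply: integral_ge0 => y _; rewrite lee_fin. Qed.

Lemma eq_Ex f h : f =1 h -> Ex f = Ex h.
Proof. by move=> fh; apply: eq_integral => y _; rewrite fh. Qed.

Lemma Ex_eq0 f : (forall y, f y = 0) -> Ex f = 0%E.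
Proof. by move=> f0; rewrite /Ex integral0_eq// => y _; rewrite f0. Qed.

Lemma ExD f h : measurable_fun setT f -> measurable_fun setT h ->
  (forall y, 0 <= f y) -> (forall y, 0 <= h y) ->
  Ex (fun y => f y + h y) = (Ex f + Ex h)%E.
Proof.
move=> mf mh f0 h0; rewrite /Ex -ge0_integralD//;
  try (by move=> y _; rewrite lee_fin); exact/measurable_EFinP.
Qed.

Lemma ExZ f c : measurable_fun setT f -> (forall y, 0 <= f y) -> 0 <= c ->
  Ex (fun y => c * f y) = (c%:E * Ex f)%E.
Proof.
move=> mf f0 c0; rewrite /Ex -ge0_integralZl//;
  try (by move=> y _; rewrite lee_fin); exact/measurable_EFinP.
Qed.

Lemma Ex_sum I (r : seq I) (f : I -> Y -> R) :
  (forall i, measurable_fun setT (f i)) -> (forall i y, 0 <= f i y) ->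
  Ex (fun y => \sum_(i <- r) f i y) = (\sum_(i <- r) Ex (f i))%E.
Proof.
move=> mf f0; elim: r => [|i r IH].
  by rewrite big_nil /Ex integral0_eq// => y _; rewrite big_nil.
rewrite big_cons -IH -ExD//; first by apply: eq_Ex => y; rewrite big_cons.
- exact: measurable_sum.
- by move=> y; rewrite sumr_ge0.
Qed.

Lemma le_Ex f h : measurable_fun setT f -> measurable_fun setT h ->
  (forall y, 0 <= f y) -> (forall y, f y <= h y) -> (Ex f <= Ex h)%E.
Proof.
move=> mf mh f0 fh; apply: ge0_le_integral => //;
  try (by move=> y _; rewrite lee_fin); exact/measurable_EFinP.
Qed.

Lemma Ex_preserving (Psi : Y -> Y) f : measure_preserving mu Psi ->
  measurable_fun setT f -> (forall y, 0 <= f y) ->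
  Ex (fun y => f (Psi y)) = Ex f.
Proof.
move=> PP mf f0; rewrite /Ex -[RHS](measure_preserving_integral PP)//.
exact/measurable_EFinP.
Qed.

(** Halving remains valid at infinite values, where a common term could not be subtracted. *)
Lemma adde_diag_inj (x y : \bar R) : (x + x = y + y -> x = y)%E.
Proof.
case: x y => [x| |] [y| |]//= [xy]; congr (_%:E).
by move: xy; lra.
Qed.

(* The cross term disappears by averaging over [Psi]; as everything is
   nonnegative, no integrability is needed. *)
Lemma Ex_quad_orthogonal n (M : 'M[R]_n) (a b : Y -> 'cV[R]_n) (Psi : Y -> Y) :
  (forall x, 0 <= quad M x) -> mvec a -> mvec b -> measure_preserving mu Psi ->
  (forall y, a (Psi y) = a y) -> (forall y, b (Psi y) = - b y) ->
  Ex (fun y => quad M (a y + b y)) =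
  (Ex (fun y => quad M (a y)) + Ex (fun y => quad M (b y)))%E.
Proof.
move=> M0 ma mb PP aP bP; apply: adde_diag_inj.
have mab := measurable_quad M (mvecD ma mb).
have mab' := measurable_quad M (mvecB ma mb).
have mqa := measurable_quad M ma; have mqb := measurable_quad M mb.
(* Invariance of the measure under [Psi] exchanges [a + b] and [a - b]; the parallelogram identity
   then gives twice the claim. *)
have eN : Ex (fun y => quad M (a y - b y)) = Ex (fun y => quad M (a y + b y)).
  rewrite -(Ex_preserving PP mab)//.
  by apply: eq_Ex => y; rewrite aP bP.
rewrite -{2}eN -!ExD//; last 4 first.
- exact: measurable_funD.
- exact: measurable_funD.
- by move=> y; rewrite addr_ge0.
- by move=> y; rewrite addr_ge0.
by apply: eq_Ex => y; rewrite quad_parallelogram.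
Qed.

End expectations.

(** * Kalman filter *)

Lemma trmxD (R : pzRingType) m n (a b : 'M[R]_(m, n)) : (a + b)^T = a^T + b^T.
Proof. exact: linearD. Qed.

Lemma trmxB (R : pzRingType) m n (a b : 'M[R]_(m, n)) : (a - b)^T = a^T - b^T.
Proof. exact: linearB. Qed.

Section innovations.
Variables (R : realType) (n p N T : nat).
Variables (A : 'M[R]_n) (C : 'M[R]_(p, n)).
Variables (Gw : nat -> 'M[R]_n) (Gv : nat -> 'M[R]_p) (G0 : 'M[R]_n).
(* coefficient matrices of x_0, w_k, v_k in terms of i.i.d. normal variables *)
Variables (X0m : 'M[R]_(n, N)) (Wm : nat -> 'M[R]_(n, N)) (Vm : nat -> 'M[R]_(p, N)).

(** For a vector [xi] with identity covariance, [M *m M'^T] is the covariance of [M *m xi] and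
    [M' *m xi]. Independence of the noises thus becomes matrix algebra. *)
Record uncorrelated : Prop := Uncorrelated {
  unc_00 : X0m *m X0m^T = G0 *m G0^T;
  unc_ww : forall k, (k < T)%N -> Wm k *m (Wm k)^T = Wc Gw k;
  unc_vv : forall k, (k <= T)%N -> Vm k *m (Vm k)^T = Vc Gv k;
  unc_w0 : forall k, Wm k *m X0m^T = 0;
  unc_v0 : forall k, Vm k *m X0m^T = 0;
  unc_wv : forall k l, Wm k *m (Vm l)^T = 0;
  unc_vw : forall k l, Vm k *m (Wm l)^T = 0;
  unc_wwD : forall k l, k != l -> Wm k *m (Wm l)^T = 0;
  unc_vvD : forall k l, k != l -> Vm k *m (Vm l)^T = 0 }.

(* [Prm k], [Num k], [Emm k] are the coefficient matrices of the prior error, of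
   the innovation y_k - C xhat_{k|k-1} and of the posterior error. *)
Fixpoint Prm (k : nat) : 'M[R]_(n, N) :=
  match k with
  | 0 => X0m
  | k'.+1 => A *m (Prm k' - Kg A C Gw Gv G0 k' *m (C *m Prm k' + Vm k')) + Wm k'
  end.
Definition Num k := C *m Prm k + Vm k.
Definition Emm k := Prm k - Kg A C Gw Gv G0 k *m Num k.

Lemma PrmS k : Prm k.+1 = A *m Emm k + Wm k.
Proof. by []. Qed.

Hypothesis unc : uncorrelated.
Hypothesis unit_innov :
  forall k, C *m Pprior A C Gw Gv G0 k *m C^T + Vc Gv k \in unitmx.

Section orthogonal_to_past.
Variables (q : nat) (M : 'M[R]_(q, N)) (k : nat).
Hypotheses (M0 : M *m X0m^T = 0) (MW : forall l, (l < k)%N -> M *m (Wm l)^T = 0)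
  (MV : forall l, (l < k)%N -> M *m (Vm l)^T = 0).

(** The prior error at [l] is a combination of the initial state and of noises of index below [l];
    the innovation at [l] also contains [Vm l], whence the strict bound in the next lemma. *)
Lemma past_Prm l : (l <= k)%N -> M *m (Prm l)^T = 0.
Proof.
elim: l => [//|l IH] lk.
rewrite PrmS trmxD trmx_mul /Emm trmxB trmx_mul /Num trmxD trmx_mul.
rewrite mulmxDr mulmxA mulmxBr mulmxA mulmxDr mulmxA IH ?(ltnW lk)//.
by rewrite MW// MV// !(mul0mx, addr0, subr0).
Qed.

Lemma past_Num l : (l < k)%N -> M *m (Num l)^T = 0.
Proof.
move=> lk; rewrite /Num trmxD trmx_mul mulmxDr mulmxA past_Prm ?(ltnW lk)//.
by rewrite MV// mul0mx addr0.
Qed.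

End orthogonal_to_past.

Lemma Wm_Num k l : (l <= k)%N -> Wm k *m (Num l)^T = 0.
Proof.
move=> lk; rewrite /Num trmxD trmx_mul mulmxDr mulmxA (unc_wv unc) addr0.
rewrite (@past_Prm _ _ k) ?mul0mx//; first exact: unc_w0.
- by move=> i ik; rewrite (unc_wwD unc)// gtn_eqF.
- by move=> i _; rewrite (unc_wv unc).
Qed.

Lemma Wm_Emm k l : (l <= k)%N -> Wm k *m (Emm l)^T = 0.
Proof.
move=> lk; rewrite /Emm trmxB trmx_mul mulmxBr mulmxA Wm_Num// mul0mx subr0.
rewrite (@past_Prm _ _ k)//; first exact: unc_w0.
- by move=> i ik; rewrite (unc_wwD unc)// gtn_eqF.
- by move=> i _; rewrite (unc_wv unc).
Qed.

Lemma Vm_Prm k l : (l <= k)%N -> Vm k *m (Prm l)^T = 0.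
Proof.
move=> lk; apply: (@past_Prm _ _ k) => //; first exact: unc_v0.
- by move=> i ik; rewrite (unc_vw unc).
- by move=> i ik; rewrite (unc_vvD unc)// gtn_eqF.
Qed.

Lemma Vm_Num k l : (l < k)%N -> Vm k *m (Num l)^T = 0.
Proof.
move=> lk; apply: (@past_Num _ _ k) => //; first exact: unc_v0.
- by move=> i ik; rewrite (unc_vw unc).
- by move=> i ik; rewrite (unc_vvD unc)// gtn_eqF.
Qed.

Let KgE k : Kg A C Gw Gv G0 k *m (C *m Pprior A C Gw Gv G0 k *m C^T + Vc Gv k) =
  Pprior A C Gw Gv G0 k *m C^T.
Proof. by rewrite /Kg /kgain_of mulmxKV. Qed.

Section covariance_step.
Variable k : nat.
Hypotheses (kT : (k <= T)%N) (PP : Prm k *m (Prm k)^T = Pprior A C Gw Gv G0 k).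

Let PV : Prm k *m (Vm k)^T = 0.
Proof. by rewrite -[LHS]trmxK trmx_mul trmxK Vm_Prm// trmx0. Qed.

Let PN : Prm k *m (Num k)^T = Pprior A C Gw Gv G0 k *m C^T.
Proof. by rewrite /Num trmxD trmx_mul mulmxDr mulmxA PP PV addr0. Qed.

(** These are the normal equations: the Kalman gain is the one whose product with the innovation
    covariance is [P *m C^T], the covariance of prior error and innovation. *)
Lemma Emm_Num_eq : Emm k *m (Num k)^T = 0.
Proof.
rewrite /Emm mulmxBl PN -mulmxA.
have -> : Num k *m (Num k)^T = C *m Pprior A C Gw Gv G0 k *m C^T + Vc Gv k.
  rewrite {1}/Num mulmxDl -mulmxA PN mulmxA; congr (_ + _).
  by rewrite /Num trmxD trmx_mul mulmxDr mulmxA Vm_Prm// mul0mx add0r (unc_vv unc).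
by rewrite KgE subrr.
Qed.

Lemma Emm_cov : Emm k *m (Emm k)^T =
  (1%:M - Kg A C Gw Gv G0 k *m C) *m Pprior A C Gw Gv G0 k.
Proof.
rewrite {2}/Emm trmxB trmx_mul mulmxBr mulmxA Emm_Num_eq mul0mx subr0.
rewrite /Emm mulmxBl PP [RHS]mulmxBl mul1mx; congr (_ - _).
rewrite -!mulmxA; congr (_ *m _).
by rewrite /Num mulmxDl -mulmxA PP Vm_Prm// addr0.
Qed.

End covariance_step.

(** The Riccati-type recursion [Pprior] is the actual error covariance; the fresh noise [Wm k] is
    uncorrelated with the posterior error, so no cross term appears. *)
Lemma Prm_cov k : (k <= T)%N -> Prm k *m (Prm k)^T = Pprior A C Gw Gv G0 k.
Proof.
elim: k => [|k IH] kT; first exact: unc_00.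
have EW : Emm k *m (Wm k)^T = 0.
  by rewrite -[LHS]trmxK trmx_mul trmxK Wm_Emm// trmx0.
rewrite PrmS trmxD trmx_mul mulmxDr mulmxDl mulmxDl mulmxA -(mulmxA A) Emm_cov//;
  [|exact: ltnW|exact: IH (ltnW kT)].
rewrite (mulmxA (Wm k)) Wm_Emm// mul0mx addr0 -(mulmxA A (Emm k) (Wm k)^T) EW.
by rewrite mulmx0 add0r (unc_ww unc).
Qed.

(** Orthogonality obtained at time [k] from the gain is carried forward, since later noises are
    uncorrelated with the innovation of time [k]. *)
Lemma Emm_Num t k : (k <= t <= T)%N -> Emm t *m (Num k)^T = 0.
Proof.
elim: t => [|t IH] /andP[].
  by rewrite leqn0 => /eqP -> _; apply: Emm_Num_eq => //; exact: Prm_cov.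
rewrite leq_eqVlt => /predU1P[->|kt] tT.
  by apply: Emm_Num_eq => //; exact: Prm_cov.
have P0 : Prm t.+1 *m (Num k)^T = 0.
  by rewrite PrmS mulmxDl -mulmxA IH ?mulmx0 ?Wm_Num ?addr0// -ltnS kt ltnW.
have N0 : Num t.+1 *m (Num k)^T = 0.
  by rewrite {1}/Num mulmxDl -mulmxA P0 Vm_Num// mulmx0 addr0.
by rewrite /Emm mulmxBl P0 -mulmxA N0 mulmx0 subr0.
Qed.

(** The later innovation is built from the preceding posterior error and fresh noises, all
    uncorrelated with earlier innovations. *)
Lemma Num_Num l k : (l <= T)%N -> (k <= T)%N -> l != k -> Num l *m (Num k)^T = 0.
Proof.
have gt t i : (i < t <= T)%N -> Num t *m (Num i)^T = 0.
  case: t => // t /andP[it tT].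
  rewrite {1}/Num mulmxDl -mulmxA PrmS mulmxDl -mulmxA Emm_Num ?mulmx0; last first.
    by rewrite -ltnS it ltnW.
  by rewrite Wm_Num// Vm_Num// !addr0 mulmx0.
move=> lT kT; rewrite neq_ltn => /orP[lk|kl]; last by rewrite gt// kl.
by rewrite -[LHS]trmxK trmx_mul trmxK gt ?trmx0// lk.
Qed.

End innovations.

(** * Riccati recursion *)

Section linear_quadratic.
Variables (R : realType) (n m : nat).
Variables (A : 'M[R]_n) (B : 'M[R]_(n, m)) (Q : 'M[R]_n) (Rc : 'M[R]_m).

Lemma pd_unitmx q (M : 'M[R]_q) : pd M -> M \in unitmx.
Proof.
move=> [_ M0]; rewrite -row_free_unit -kermx_eq0; apply/negPn/negP.
move=> /rowV0Pn[v /sub_kermxP vM v0].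
have := M0 v^T; rewrite -trmx0 (inj_eq trmx_inj) v0 => /(_ isT).
by rewrite /quad trmxK vM mul0mx mxE ltxx.
Qed.

Lemma pd_addB (S : 'M[R]_n) : pd Rc -> psd S -> pd (Rc + B^T *m S *m B).
Proof.
move=> [Rs R0] pS; have [Ss S0] := psd_mul B pS; split; first by rewrite trmxD Ss Rs.
by move=> x x0; rewrite quad_addl ltr_wpDr// R0.
Qed.

(** Completing the square in [u]: the cross terms match because [K = invmx M *m B^T *m S *m A]
    satisfies [M *m K = B^T *m S *m A]. *)
Lemma lq_square (S : 'M[R]_n) (x : 'cV[R]_n) (u : 'cV[R]_m) :
  let M := Rc + B^T *m S *m B in
  S^T = S -> M^T = M -> M \in unitmx ->
  quad Q x + quad Rc u + quad S (A *m x + B *m u) =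
  quad (ric_step A B Q Rc S) x + quad M (u + invmx M *m B^T *m S *m A *m x).
Proof.
move=> M Ss Ms Mu; pose K := invmx M *m B^T *m S *m A.
have MK : M *m K = B^T *m S *m A by rewrite /K !mulmxA mulmxV// mul1mx.
have KM : K^T *m M = A^T *m S *m B.
  by rewrite -[LHS]trmxK trmx_mul trmxK Ms MK !trmx_mul trmxK Ss mulmxA.
have KMK : K^T *m M *m K = A^T *m (S *m B *m invmx M *m B^T *m S) *m A.
  by rewrite KM /K !mulmxA.
have e1 : quad (ric_step A B Q Rc S) x =
    quad Q x + (quad (A^T *m S *m A) x - quad (K^T *m M *m K) x).
  rewrite KMK /ric_step -/M quad_addl; congr (_ + _).
  by rewrite mulmxBr mulmxBl quad_subl.
have mulD q r (Z : 'M[R]_(q, r)) (a b : 'cV[R]_q) c : ((a + b)^T *m Z *m c) ord0 ord0 =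
    (a^T *m Z *m c) ord0 ord0 + (b^T *m Z *m c) ord0 ord0.
  by rewrite trmxD !mulmxDl mxE.
have Dmul q r (Z : 'M[R]_(q, r)) (a b : 'cV[R]_r) c : (c^T *m Z *m (a + b)) ord0 ord0 =
    (c^T *m Z *m a) ord0 ord0 + (c^T *m Z *m b) ord0 ord0.
  by rewrite mulmxDr mxE.
have e2 : quad S (A *m x + B *m u) = quad (A^T *m S *m A) x
    + (x^T *m (A^T *m S *m B) *m u) ord0 ord0
    + (u^T *m (B^T *m S *m A) *m x) ord0 ord0 + quad (B^T *m S *m B) u.
  by rewrite /quad mulD !Dmul !trmx_mul !mulmxA !addrA.
have e3 : quad M (u + K *m x) = quad M u
    + (u^T *m (B^T *m S *m A) *m x) ord0 ord0
    + (x^T *m (A^T *m S *m B) *m u) ord0 ord0 + quad (K^T *m M *m K) x.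
  by rewrite -MK -KM /quad mulD !Dmul !trmx_mul !mulmxA !addrA.
rewrite -/K e1 e2 e3 /M quad_addl; ring.
Qed.

Variables (Lam : 'M[R]_n) (T : nat).
Hypotheses (psdQ : psd Q) (psdLam : psd Lam) (pdR : pd Rc).

(** At the minimizing input the square in [lq_square] vanishes, which exhibits the form of
    [ric_step] as a sum of nonnegative costs. *)
Lemma psd_ric_step (S : 'M[R]_n) : psd S -> psd (ric_step A B Q Rc S).
Proof.
move=> pS; have pM := pd_addB pdR pS; have [Ss S0] := pS; have [Qs Q0] := psdQ.
split.
  have Mu := pd_unitmx pM; have [Ms _] := pM.
  rewrite /ric_step trmxD Qs !trmx_mul trmxK trmxB Ss !trmx_mul trmxK trmx_inv Ms Ss.
  by rewrite !mulmxA.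
move=> x; set M := Rc + B^T *m S *m B.
have := lq_square x (- (invmx M *m B^T *m S *m A *m x)) Ss (proj1 pM) (pd_unitmx pM).
rewrite /= -/M addNr quad0 addr0 => <-.
rewrite !addr_ge0//; case: pdR => _ R0.
by have [->|/R0/ltW//] := eqVneq (- (invmx M *m B^T *m S *m A *m x)) 0; rewrite quad0.
Qed.

Lemma psd_Sric k : psd (Sric A B Q Rc Lam T k).
Proof.
by rewrite /Sric; elim: (T - k)%N => //= t IH; exact: psd_ric_step.
Qed.

Lemma psd_Gam k : psd (Gam A B Q Rc Lam T k).
Proof.
have [Ms M0] := pd_addB pdR (psd_Sric k.+1).
rewrite /Gam; apply: psd_mul; split=> // x.
by have [->|/M0/ltW//] := eqVneq x 0; rewrite quad0.
Qed.

(** Feeding the gain with [h] instead of [x] leaves the square of the gain applied to [x - h], whose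
    weight is [Gam]. *)
Lemma lq_step k (x h : 'cV[R]_n) : (k < T)%N ->
  let u := - (Lgain A B Q Rc Lam T k *m h) in
  quad Q x + quad Rc u + quad (Sric A B Q Rc Lam T k.+1) (A *m x + B *m u) =
  quad (Sric A B Q Rc Lam T k) x + quad (Gam A B Q Rc Lam T k) (x - h).
Proof.
move=> kT u; have pS := psd_Sric k.+1; have pM := pd_addB pdR pS.
rewrite lq_square; [|by case: pS|by case: pM|exact: pd_unitmx].
have -> : Sric A B Q Rc Lam T k = ric_step A B Q Rc (Sric A B Q Rc Lam T k.+1).
  by rewrite /Sric -(subnSK kT).
congr (_ + _); rewrite /Gam -quad_mul; congr (quad _ _).
by rewrite /u mulmxBr addrC /Lgain kT.
Qed.

End linear_quadratic.

(** * Canonical Gaussian space of finitely many noise scalars *)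

Section canonical_space.
Variables (R : realType) (s : seq nidx).
Hypothesis us : uniq s.

Definition sel q (f : 'I_q -> nidx) : 'M[R]_(q, size s) :=
  \matrix_(i, a) (nth (I0 0) s a == f i)%:R.

(** The coordinate labelled [i], written as a sum so as to be linear and defined for every label; it
    is 0 for a label outside [s]. *)
Definition gc (i : nidx) (x : gspace R (size s)) : R :=
  \sum_(a < size s) (nth (I0 0) s a == i)%:R * (x : 'cV[R]_(size s)) a ord0.

Lemma gc_sel q (f : 'I_q -> nidx) x :
  \col_i gc (f i) x = sel f *m (x : 'cV[R]_(size s)).
Proof.
apply/matrixP => i j; rewrite ord1 !mxE.
by apply: eq_bigr => a _; rewrite mxE.
Qed.

Lemma sel_disj q r (f : 'I_q -> nidx) (h : 'I_r -> nidx) :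
  (forall i j, f i != h j) -> sel f *m (sel h)^T = 0.
Proof.
move=> fh; apply/matrixP => i j; rewrite !mxE big1// => a _; rewrite !mxE.
by case: eqP => [->|]; rewrite ?mul0r// (negbTE (fh i j)) mulr0.
Qed.

Lemma sel_id q (f : 'I_q -> nidx) : injective f -> (forall i, f i \in s) ->
  sel f *m (sel f)^T = 1%:M.
Proof.
move=> fI fs; apply/matrixP => i j; rewrite !mxE.
have ia : (index (f i) s < size s)%N by rewrite index_mem.
rewrite (bigD1 (Ordinal ia))//= !mxE /= nth_index// eqxx mul1r (inj_eq fI).
rewrite big1 ?addr0// => a ai; rewrite !mxE; case: eqP => [E|]; last by rewrite mul0r.
case/eqP: ai; apply: val_inj => /=.
by rewrite -E index_uniq.
Qed.

Definition xi (d : measure_display) (Omega : measurableType d)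
    (g : nidx -> Omega -> R) (w : Omega) : gspace R (size s) :=
  (\col_a g (nth (I0 0) s a) w : 'cV[R]_(size s)).

Section law.
Context d (Omega : measurableType d) (P : probability Omega R).
Variable g : nidx -> Omega -> R.

Lemma gc_xi i w : i \in s -> gc i (xi g w) = g i w.
Proof.
move=> si; have ia : (index i s < size s)%N by rewrite index_mem.
rewrite /gc (bigD1 (Ordinal ia))//= !mxE /= nth_index// eqxx mul1r.
rewrite big1 ?addr0// => a ai; case: eqP => [E|]; last by rewrite mul0r.
case/eqP: ai; apply: val_inj => /=.
by rewrite -E index_uniq.
Qed.

Hypotheses (gN : std_normal_family P g) (gI : mutually_independent P g).

Lemma measurable_xi : measurable_fun setT (xi g).
Proof.
apply: measurable_gspace => a.
apply: (eq_measurable_fun (g (nth (I0 0) s a))); first by move=> w _; rewrite mxE.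
by case: (gN (nth (I0 0) s a)).
Qed.

Lemma std_gaussian_xi : std_gaussian (pushforward P (xi g)).
Proof.
move=> B mB.
(* The sets are moved from positions to labels, with no constraint on labels outside [s], to fit the
   form of mutual independence. *)
pose B' i := if insub (index i s) is Some a then B a else setT.
have mB' i : measurable (B' i) by rewrite /B'; case: insubP.
have B'E (a : 'I_(size s)) : B' (nth (I0 0) s a) = B a.
  by rewrite /B' index_uniq// valK.
rewrite /pushforward.
have -> : xi g @^-1` box B = \bigcap_(i in [set` s]) (g i @^-1` B' i).
  apply/seteqP; split=> w /= h.
    move=> i /= si; have ia : (index i s < size s)%N by rewrite index_mem.
    have := h (Ordinal ia); rewrite mxE -B'E /= nth_index//.
  move=> a; rewrite mxE -B'E; apply: h => /=; exact: mem_nth.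
rewrite gI// (big_nth (I0 0)) big_mkord; apply: eq_bigr => a _.
have [_ ->] := gN (nth (I0 0) s a); last exact: mB'.
by rewrite B'E.
Qed.

End law.
End canonical_space.

(** * Closed loop *)

Section loop_equations.
Context d (Omega : measurableType d) (R : realType).
Variables (n m p L T : nat).
Variables (A : 'M[R]_n) (B : 'M[R]_(n, m)) (C : 'M[R]_(p, n)).
Variables (Q : 'M[R]_n) (Rc : 'M[R]_m) (Lam : 'M[R]_n).
Variables (Gw : nat -> 'M[R]_n) (Gv : nat -> 'M[R]_p) (G0 : 'M[R]_n).
Variable g : nidx -> Omega -> R.
Variable pi : rule R n.
Local Notation xx := (state L T A B C Q Rc Lam Gw Gv G0 g pi).
Local Notation xh := (est L T A B C Q Rc Lam Gw Gv G0 g pi).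
Local Notation uu := (input L T A B C Q Rc Lam Gw Gv G0 g pi).
Local Notation K := (Kg A C Gw Gv G0).

Lemma stateS k w : xx k.+1 w = A *m xx k w + B *m uu k w + wn Gw g k w.
Proof. by rewrite /input /est /state /=; case: (cl _ _ _ _ _ _ _ _ _ _ _ _ _ k w). Qed.

(** The input is known to the filter, so it cancels from the innovation, which depends only on the
    previous estimation error and fresh noise. *)
Lemma estS1 k w : xh k.+1 w 1%N = A *m xh k w 1%N + B *m uu k w +
  K k.+1 *m (C *m (A *m (xx k w - xh k w 1%N) + wn Gw g k w) + vn Gv g k.+1 w).
Proof.
rewrite /input /est /state /=; case: (cl _ _ _ _ _ _ _ _ _ _ _ _ _ k w) => a b /=.
congr (_ + _ *m _); set u := ctrl _ _ _ _ _ _ _ _ _.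
rewrite addrAC; congr (_ + _); rewrite -mulmxBr; congr (_ *m _).
by rewrite mulmxBr addrAC opprD addrACA subrr addr0 addrAC.
Qed.

Lemma estS k w j : xh k.+1 w j.+2 =
  A *m (if delta L T A B C Q Rc Lam Gw Gv G0 g pi k j.+1 w
        then xh k w j.+1 else xh k w j.+2) + B *m uu k w.
Proof.
by rewrite /input /delta /est /=; case: (cl _ _ _ _ _ _ _ _ _ _ _ _ _ k w).
Qed.

End loop_equations.

(** Causality of the loop. Two sample spaces are allowed, so that the same fact serves reflections
    of the noise and the passage to the canonical space. *)
Lemma cl_ext d (Omega : measurableType d) d' (Omega' : measurableType d')
  (R : realType) (n m p L T : nat)
  (A : 'M[R]_n) (B : 'M[R]_(n, m)) (C : 'M[R]_(p, n))
  (Q : 'M[R]_n) (Rc : 'M[R]_m) (Lam : 'M[R]_n)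
  (Gw : nat -> 'M[R]_n) (Gv : nat -> 'M[R]_p) (G0 : 'M[R]_n)
  (g : nidx -> Omega -> R) (g' : nidx -> Omega' -> R) (pi : rule R n) w w' k :
  x0 G0 g w = x0 G0 g' w' ->
  (forall l, (l < k)%N -> wn Gw g l w = wn Gw g' l w') ->
  (forall l, (l <= k)%N -> vn Gv g l w = vn Gv g' l w') ->
  cl L T A B C Q Rc Lam Gw Gv G0 g pi k w =
  cl L T A B C Q Rc Lam Gw Gv G0 g' pi k w'.
Proof.
move=> h0; elim: k => [|k IH] hw hv; first by rewrite /= h0 hv.
rewrite /= IH; last 2 first.
- by move=> l lk; apply: hw; exact: ltnW.
- by move=> l lk; apply: hv; exact: leqW.
by case: (cl _ _ _ _ _ _ _ _ _ _ _ _ _ k w') => a b; rewrite hw// hv.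
Qed.

(** * Closed loop and control cost on the canonical space *)

Section canonical_loop.
Variables (R : realType) (n m p L T : nat).
Variables (A : 'M[R]_n) (B : 'M[R]_(n, m)) (C : 'M[R]_(p, n)).
Variables (Q : 'M[R]_n) (Rc : 'M[R]_m) (Lam : 'M[R]_n).
Variables (Gw : nat -> 'M[R]_n) (Gv : nat -> 'M[R]_p) (G0 : 'M[R]_n).
Variable s : seq nidx.
Local Notation X := (gspace R (size s)).

Definition X0m : 'M[R]_(n, size s) := G0 *m sel R s (fun i : 'I_n => I0 i).
Definition Wm k : 'M[R]_(n, size s) := Gw k *m sel R s (fun i : 'I_n => IW k i).
Definition Vm k : 'M[R]_(p, size s) := Gv k *m sel R s (fun i : 'I_p => IV k i).

Local Notation gcs := (@gc R s).

Lemma x0E (x : X) : x0 G0 gcs x = X0m *m (x : 'cV[R]_(size s)).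
Proof. by rewrite /x0 gc_sel mulmxA. Qed.

Lemma wnE k (x : X) : wn Gw gcs k x = Wm k *m (x : 'cV[R]_(size s)).
Proof. by rewrite /wn (gc_sel (fun i : 'I_n => IW k i)) mulmxA. Qed.

Lemma vnE k (x : X) : vn Gv gcs k x = Vm k *m (x : 'cV[R]_(size s)).
Proof. by rewrite /vn (gc_sel (fun i : 'I_p => IV k i)) mulmxA. Qed.

Hypothesis us : uniq s.
Hypothesis s0 : forall i, (i < n)%N -> I0 i \in s.
Hypothesis sw : forall k i, (k < T)%N -> (i < n)%N -> IW k i \in s.
Hypothesis sv : forall k i, (k <= T)%N -> (i < p)%N -> IV k i \in s.

Lemma uncorrelated_noise : uncorrelated T Gw Gv G0 X0m Wm Vm.
Proof.
have sq q r t t' (M : 'M[R]_(q, r)) (M' : 'M[R]_(t, t'))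
    (U : 'M[R]_(r, size s)) (V : 'M[R]_(t', size s)) :
    U *m V^T = 0 -> (M *m U) *m (M' *m V)^T = 0.
  by move=> UV; rewrite trmx_mul mulmxA -(mulmxA M) UV mulmx0 mul0mx.
have sd q r (M : 'M[R]_(q, r)) (U : 'M[R]_(r, size s)) :
    U *m U^T = 1%:M -> (M *m U) *m (M *m U)^T = M *m M^T.
  by move=> UU; rewrite trmx_mul mulmxA -(mulmxA M) UU mulmx1.
split.
- by apply: sd; apply: sel_id => //; [move=> i j [] /val_inj|move=> i; exact: s0].
- move=> k kT.
  by apply: sd; apply: sel_id => //; [move=> i j [] /val_inj|move=> i; exact: sw].
- move=> k kT.
  by apply: sd; apply: sel_id => //; [move=> i j [] /val_inj|move=> i; exact: sv].
- by move=> k; apply/sq/sel_disj => i j; apply/eqP.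
- by move=> k; apply/sq/sel_disj => i j; apply/eqP.
- by move=> k l; apply/sq/sel_disj => i j; apply/eqP.
- by move=> k l; apply/sq/sel_disj => i j; apply/eqP.
- by move=> k l kl; apply/sq/sel_disj => i j; apply/eqP => -[/eqP]; rewrite (negbTE kl).
- by move=> k l kl; apply/sq/sel_disj => i j; apply/eqP => -[/eqP]; rewrite (negbTE kl).
Qed.

Definition mrule (pi : rule R n) : Prop :=
  forall (f : X -> nat -> 'cV[R]_n), (forall j, mvec (fun x => f x j)) ->
  forall k j, measurable_fun setT (fun x => pi k (f x) j).

Variable pi : rule R n.
Hypothesis mpi : mrule pi.
Local Notation xx := (state L T A B C Q Rc Lam Gw Gv G0 gcs pi).
Local Notation xh := (est L T A B C Q Rc Lam Gw Gv G0 gcs pi).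
Local Notation uu := (input L T A B C Q Rc Lam Gw Gv G0 gcs pi).

Lemma mvec_lin q (M : 'M[R]_(q, size s)) :
  mvec (fun x : X => M *m (x : 'cV[R]_(size s))).
Proof. by apply: mvec_mul => i; exact: measurable_coord. Qed.

Lemma mvec_wn k : mvec (wn Gw gcs k).
Proof. by apply: eq_ind (mvec_lin (Wm k)) _ _; apply/funext => x; rewrite wnE. Qed.

Lemma mvec_vn k : mvec (vn Gv gcs k).
Proof. by apply: eq_ind (mvec_lin (Vm k)) _ _; apply/funext => x; rewrite vnE. Qed.

Lemma mvec_x0 : mvec (x0 G0 gcs).
Proof. by apply: eq_ind (mvec_lin X0m) _ _; apply/funext => x; rewrite x0E. Qed.

Lemma mvec_loop k : mvec (xx k) /\ forall j, mvec (fun x => xh k x j).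
Proof.
elim: k => [|k [IHx IHh]].
  split=> [|j]; first exact: mvec_x0.
  rewrite /est /=; case: (j == 1)%N; last exact: mvec_cst.
  apply: mvec_mul; apply: mvecD; last exact: mvec_vn.
  by apply: mvec_mul; exact: mvec_x0.
have mu_ : mvec (uu k) by apply: mvecN; apply: mvec_mul; exact: IHh.
split=> [|j].
  have h := mvecD (mvecD (mvec_mul A IHx) (mvec_mul B mu_)) (mvec_wn k).
  by apply: eq_ind h _ _; apply/funext => x; rewrite stateS.
case: j => [|[|j]].
(* Index 0 is no decision maker: there [j.-1] is again 0 and both branches coincide. *)
- have h := mvecD (mvec_mul A (mvec_if (mpi IHh k 0) (IHh 0%N) (IHh 0%N))) (mvec_mul B mu_).
  apply: eq_ind h _ _; apply/funext => x.
  by rewrite /input /est /=; case: (cl _ _ _ _ _ _ _ _ _ _ _ _ _ k x).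
- have he := mvec_mul A (mvecB IHx (IHh 1%N)).
  have hz := mvec_mul (Kg A C Gw Gv G0 k.+1)
    (mvecD (mvec_mul C (mvecD he (mvec_wn k))) (mvec_vn k.+1)).
  have h := mvecD (mvecD (mvec_mul A (IHh 1%N)) (mvec_mul B mu_)) hz.
  by apply: eq_ind h _ _; apply/funext => x; rewrite estS1.
- have h := mvecD (mvec_mul A (mvec_if (mpi IHh k j.+1) (IHh j.+1) (IHh j.+2)))
    (mvec_mul B mu_).
  by apply: eq_ind h _ _; apply/funext => x; rewrite estS.
Qed.

Lemma mvec_state k : mvec (xx k). Proof. by case: (mvec_loop k). Qed.
Lemma mvec_est k j : mvec (fun x => xh k x j). Proof. by case: (mvec_loop k). Qed.
Lemma mvec_input k : mvec (uu k).
Proof. by apply: mvecN; apply: mvec_mul; exact: mvec_est. Qed.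
Lemma measurable_delta k j :
  measurable_fun setT (delta L T A B C Q Rc Lam Gw Gv G0 gcs pi k j).
Proof. by apply: mpi => i; exact: mvec_est. Qed.

Local Notation Em := (Emm A C Gw Gv G0 X0m Wm Vm).
Local Notation Nm := (Num A C Gw Gv G0 X0m Wm Vm).
Definition zeta k (x : X) : 'cV[R]_n :=
  Kg A C Gw Gv G0 k *m (Nm k *m (x : 'cV[R]_(size s))).

(** Input and schedule cancel in the Kalman error, which is therefore a linear function of the
    noise, the same for every rule. *)
Lemma error_lin k (x : X) : xx k x - xh k x 1%N = Em k *m (x : 'cV[R]_(size s)).
Proof.
elim: k => [|k IH].
  rewrite /state /est /= x0E vnE /Emm /Num /=.
  by rewrite !(mulmxBl, mulmxDl, mulmxDr) !mulmxA.
rewrite stateS estS1 IH wnE vnE [in RHS]/Emm [RHS]mulmxBl /Num PrmS.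
rewrite opprD addrA; congr (_ - _); last by rewrite !(mulmxDl, mulmxDr, mulmxA).
rewrite mulmxDl -(mulmxA A) -IH mulmxBr.
by rewrite addrAC opprD addrACA subrr addr0 addrAC.
Qed.

Lemma est1S k (x : X) :
  xh k.+1 x 1%N = A *m xh k x 1%N + B *m uu k x + zeta k.+1 x.
Proof.
rewrite estS1 error_lin wnE vnE /zeta; congr (_ + _ *m _).
by rewrite /Num PrmS mulmxDl -mulmxA mulmxDl -mulmxA.
Qed.

Lemma est10 (x : X) : xh 0%N x 1%N = zeta 0 x.
Proof. by rewrite /est /= x0E vnE /zeta /Num /= mulmxDl -mulmxA. Qed.

Variable mu : {measure set X -> \bar R}.
Hypothesis muG : std_gaussian mu.
Hypotheses (psdQ : psd Q) (psdLam : psd Lam) (pdR : pd Rc).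
Local Notation S := (Sric A B Q Rc Lam T).
Local Notation Gamma := (Gam A B Q Rc Lam T).

(** Reflecting the components of [w_k] negates it and, by causality, leaves the loop at time [k]
    unchanged. *)
Lemma noise_step k : (k < T)%N ->
  Ex mu (fun x => quad (S k.+1) (xx k.+1 x)) =
  (Ex mu (fun x => quad (S k.+1) (A *m xx k x + B *m uu k x)%R)
   + Ex mu (fun x => quad (S k.+1) (wn Gw gcs k x)))%E.
Proof.
move=> kT; have [U [Up UF Ufix]] := reflection_ex muG (sel R s (fun i : 'I_n => IW k i)).
have clU x : cl L T A B C Q Rc Lam Gw Gv G0 gcs pi k (U *m x : 'cV[R]_(size s)) =
    cl L T A B C Q Rc Lam Gw Gv G0 gcs pi k x.
  apply: cl_ext => [|l lk|l _].
  - rewrite !x0E mulmxA -(mulmxA G0) Ufix//; apply: sel_disj => i j; exact/eqP.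
  - rewrite !wnE mulmxA -(mulmxA (Gw l)) Ufix//; apply: sel_disj => i j.
    by apply/eqP => -[lE _]; rewrite lE ltnn in lk.
  - rewrite !vnE mulmxA -(mulmxA (Gv l)) Ufix//; apply: sel_disj => i j; exact/eqP.
rewrite -(Ex_quad_orthogonal (a := fun x => A *m xx k x + B *m uu k x)
   (b := wn Gw gcs k) (proj2 (psd_Sric A B T psdQ psdLam pdR k.+1)) _ _ Up).
- by apply: eq_Ex => x; rewrite stateS.
- apply: mvecD; apply: mvec_mul; [exact: mvec_state|exact: mvec_input].
- exact: mvec_wn.
- by move=> x; rewrite /input /state /est clU.
- by move=> x; rewrite !wnE mulmxA -(mulmxA (Gw k)) UF mulmxN mulNmx.
Qed.

Let stage k (x : X) := quad Q (xx k x) + quad Rc (uu k x).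

Let stage_ge0 k x : 0 <= stage k x.
Proof.
rewrite /stage addr_ge0 ?(proj2 psdQ)//.
have [->|u0] := eqVneq (uu k x) 0; first by rewrite quad0.
by rewrite ltW// (proj2 pdR).
Qed.

Let mstage k : measurable_fun setT (stage k).
Proof.
apply: measurable_funD; apply: measurable_quad; [exact: mvec_state|exact: mvec_input].
Qed.

(** Forward induction with [noise_step] and [lq_step]. The remaining cost stays on the left, so
    expectations are only added, never subtracted. *)
Lemma cost_prefix k : (k <= T)%N ->
  (Ex mu (fun x => quad (S k) (xx k x)) +
   Ex mu (fun x => (\sum_(i < k) stage i x)%R) =
  Ex mu (fun x => quad (S 0%N) (x0 G0 gcs x)) +
  \sum_(i < k) (Ex mu (fun x => quad (Gamma i) (xx i x - xh i x L.+1)%R) +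
     Ex mu (fun x => quad (S i.+1) (wn Gw gcs i x))))%E.
Proof.
elim: k => [_|k IH kT].
  by rewrite big_ord0 [X in (_ + X)%E]Ex_eq0// => x; rewrite big_ord0.
have pS k' := proj2 (psd_Sric A B T psdQ psdLam pdR k').
have msum : measurable_fun setT (fun x => \sum_(i < k) stage i x).
  by apply: measurable_sum => i; exact: mstage.
have sum0 x : 0 <= \sum_(i < k) stage i x by apply: sumr_ge0.
have mAB : mvec (fun x => A *m xx k x + B *m uu k x).
  by apply: mvecD; apply: mvec_mul; [exact: mvec_state|exact: mvec_input].
rewrite noise_step// [in RHS]big_ord_recr /= [RHS]addeA -IH; last exact: ltnW.
have -> : Ex mu (fun x => \sum_(i < k.+1) stage i x) =
    (Ex mu (fun x => (\sum_(i < k) stage i x)%R) + Ex mu (stage k))%E.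
  by rewrite -ExD//; apply: eq_Ex => x; rewrite big_ord_recr.
have hk : (Ex mu (fun x => quad (S k.+1) (A *m xx k x + B *m uu k x)%R) +
     Ex mu (stage k) = Ex mu (fun x => quad (S k) (xx k x)) +
     Ex mu (fun x => quad (Gamma k) (xx k x - xh k x L.+1)%R))%E.
  have mq q (M : 'M[R]_q) (f : X -> 'cV[R]_q) : mvec f ->
    measurable_fun setT (fun x => quad M (f x)) by exact: measurable_quad.
  rewrite -!ExD//.
  - apply: eq_Ex => x; rewrite addrC /stage.
    exact: (lq_step A B psdQ psdLam pdR (xx k x) (xh k x L.+1) kT).
  - by apply: mq; exact: mvec_state.
  - by apply: mq; apply: mvecB; [exact: mvec_state|exact: mvec_est].
  - by move=> x; exact: (proj2 (psd_Gam A B T psdQ psdLam pdR k)).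
  - exact: mq.
rewrite (addeC (Ex mu (fun x => \sum_(i < k) stage i x)) (Ex mu (stage k))).
rewrite addeACA hk [RHS]addeACA; congr (_ + _)%E.
by rewrite addeC.
Qed.

Lemma cost_eq :
  (Ex mu (fun x => (quad Lam (xx T x) +
     \sum_(k < T) (quad Q (xx k x) + quad Rc (uu k x)))%R) =
  Ex mu (fun x => quad (S 0%N) (x0 G0 gcs x)) +
  \sum_(i < T) (Ex mu (fun x => quad (Gamma i) (xx i x - xh i x L.+1)%R) +
     Ex mu (fun x => quad (S i.+1) (wn Gw gcs i x))))%E.
Proof.
rewrite -cost_prefix// -ExD.
- by apply: eq_Ex => x; rewrite /Sric subnn.
- by apply: measurable_quad; exact: mvec_state.
- by apply: measurable_sum => i; exact: mstage.
- by move=> x; exact: (proj2 (psd_Sric A B T psdQ psdLam pdR _)).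
- by move=> x; apply: sumr_ge0.
Qed.

End canonical_loop.

(** * Mismatch errors *)

(** Every level set of [pat] is invariant under each [Psi c], so the glued map acts on each piece as
    one of them, and measures of pieces add up. *)
Lemma preserving_piecewise d (X : measurableType d) (R : realType)
    (mu : {measure set X -> \bar R}) (D : finType) (pat : X -> D) (Psi : D -> X -> X) :
  (forall c, measurable (pat @^-1` [set c])) ->
  (forall c, measure_preserving mu (Psi c)) ->
  (forall c x, pat (Psi c x) = pat x) ->
  measure_preserving mu (fun x => Psi (pat x) x).
Proof.
move=> mpat PsiP patP.
have mPsi c S : measurable S -> measurable (Psi c @^-1` S).
  by move=> mS; rewrite -[X in measurable X]setTI; apply: (proj1 (PsiP c)).
have split_pat (S : set X) : S = \bigcup_(c in [set: D]) (pat @^-1` [set c] `&` S).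
  apply/seteqP; split=> [x Sx|x [c _ []]//]; first by exists (pat x).
have E (S : set X) c : pat @^-1` [set c] `&` (fun x => Psi (pat x) x) @^-1` S =
    Psi c @^-1` (pat @^-1` [set c] `&` S).
  apply/seteqP; split=> x /= [px Sx].
    by rewrite patP; split=> //; rewrite -px.
  by move: px; rewrite patP => px; split=> //; rewrite px.
have mS1 (S : set X) : measurable S -> measurable ((fun x => Psi (pat x) x) @^-1` S).
  move=> mS; rewrite (split_pat (_ @^-1` S)).
  apply: fin_bigcup_measurable; first exact: finite_finset.
  by move=> c _; rewrite E; apply: mPsi; exact: measurableI.
split; first by move=> _ S mS; rewrite setTI; exact: mS1.
have sum_pat (S : set X) : measurable S ->
    mu S = (\sum_(c \in [set: D]) mu (pat @^-1` [set c] `&` S))%E.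
  move=> mS; rewrite {1}(split_pat S); apply: measure_fin_bigcup => //.
  - exact: finite_finset.
  - by move=> c c' _ _ [x [[<- _] [<- _]]].
  - by move=> c _; exact: measurableI.
move=> S mS; rewrite sum_pat; last exact: mS1.
rewrite [RHS]sum_pat//; apply: eq_fsbigr => c _.
by rewrite E (proj2 (PsiP c))//; exact: measurableI.
Qed.

Section mismatch.
Context d (X : measurableType d) (R : realType).
Variables (mu : {measure set X -> \bar R}) (n T I : nat) (A : 'M[R]_n).
Variables (Z : nat -> X -> 'cV[R]_n) (rho : nat -> nat -> 'cV[R]_n -> bool).

(** Recursion of the mismatches, input eliminated: the innovation enters mismatch 1, and a
    transmission at hop [j] moves the content of mismatch [j] to [j + 1]. Index 0 is a dummy. *)
Fixpoint mmz (z : nat -> 'cV[R]_n) (t i : nat) : 'cV[R]_n :=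
  match t, i with
  | 0, i => if i == 1%N then z 0%N else 0
  | t'.+1, 0 => 0
  | t'.+1, 1 => z t + A *m (if rho t' 1 (mmz z t' 1) then 0 else mmz z t' 1)
  | t'.+1, (i'.+1 as j).+1 =>
      A *m ((if rho t' j (mmz z t' j) then mmz z t' j else 0) +
            (if rho t' i (mmz z t' i) then 0 else mmz z t' i))
  end.

Lemma mmz_ext z z' t i : (forall k, (k <= t)%N -> z k = z' k) ->
  mmz z t i = mmz z' t i.
Proof.
elim: t i => [|t IH] i zz; first by rewrite /= zz.
have IH' j : mmz z t j = mmz z' t j by apply: IH => k kt; apply: zz; exact: leqW.
by case: i => [|[|i]]//=; rewrite !IH' ?zz.
Qed.

Definition mm t i x := mmz (Z^~ x) t i.
Definition unsent t i x := if rho t i (mm t i x) then 0 else mm t i x.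
(** By telescoping this stands for the gap between the first and the [j]-th estimate. *)
Definition Dm t j x := \sum_(1 <= i < j) mm t i x.

Lemma mmS1 t x : mm t.+1 1 x = Z t.+1 x + A *m unsent t 1 x.
Proof. by []. Qed.

Lemma mmS t i x : mm t.+1 i.+2 x =
  A *m ((if rho t i.+1 (mm t i.+1 x) then mm t i.+1 x else 0) + unsent t i.+2 x).
Proof. by []. Qed.

(** A transmission from hop [i] stays inside the sum, being received at [i + 1]; only what the last
    hop transmits leaves it. *)
Lemma DmS t j x : Dm t.+1 j.+2 x = Z t.+1 x + A *m (Dm t j.+1 x + unsent t j.+1 x).
Proof.
elim: j => [|j IH].
  by rewrite /Dm big_nat1 big_geq// add0r.
rewrite /Dm big_nat_recr //= -/(Dm _ _ _) IH -addrA -mulmxDr; congr (_ + _ *m _).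
rewrite [in RHS]big_nat_recr //= -/(Dm t j.+1 x) -!addrA; congr (_ + _).
rewrite -/(mm t j.+1 x) -/(mm t j.+2 x) /unsent addrA; congr (_ + _).
by case: ifP => _; rewrite ?add0r ?addr0.
Qed.

Definition sg (b : bool) (v : 'cV[R]_n) := if b then - v else v.

Lemma sgD b u v : sg b (u + v) = sg b u + sg b v.
Proof. by case: b; rewrite //= opprD. Qed.

Lemma sg_mul b (v : 'cV[R]_n) : A *m sg b v = sg b (A *m v).
Proof. by case: b; rewrite //= mulmxN. Qed.

Lemma sg0 b : sg b 0 = 0. Proof. by case: b; rewrite //= oppr0. Qed.

Hypothesis rhoN : forall k j v, rho k j (- v) = rho k j v.
Hypothesis mrho : forall k j f, mvec f -> measurable_fun setT (fun x : X => rho k j (f x)).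
Hypothesis mZ : forall k, mvec (Z k).
Hypothesis flipZ : forall tau : nat -> bool, exists2 Psi, measure_preserving mu Psi &
  forall k x, (k <= T)%N -> Z k (Psi x) = sg (tau k) (Z k x).

Lemma rho_sg k j b v : rho k j (sg b v) = rho k j v.
Proof. by case: b => /=. Qed.

Lemma mvec_mm t i : mvec (mm t i).
Proof.
elim: t i => [|t IH] i.
  by rewrite /mm /=; case: (i == 1)%N; [exact: mZ|exact: mvec_cst].
case: i => [|[|i]]; rewrite /mm /=; first exact: mvec_cst.
  apply: mvecD; first exact: mZ.
  by apply: mvec_mul; apply: mvec_if; [apply: mrho; exact: IH|exact: mvec_cst|exact: IH].
apply: mvec_mul; apply: mvecD.
  by apply: mvec_if; [apply: mrho; exact: IH|exact: IH|exact: mvec_cst].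
by apply: mvec_if; [apply: mrho; exact: IH|exact: mvec_cst|exact: IH].
Qed.

Lemma mvec_unsent t i : mvec (unsent t i).
Proof.
by apply: mvec_if; [apply: mrho; exact: mvec_mm|exact: mvec_cst|exact: mvec_mm].
Qed.

Lemma mvec_Dm t j : mvec (Dm t j).
Proof. by apply: mvec_sum => i; exact: mvec_mm. Qed.

(* Every innovation sits, at each time, in exactly one mismatch and is moved one
   hop further by a transmission, so the sign wanted at time t + 1 determines
   the sign at time t once the pattern of transmissions is fixed; evenness of
   the rule makes that pattern invariant. *)
Lemma flip_mm t (sigma tau : nat -> bool) : (t <= T)%N ->
  exists2 Psi, measure_preserving mu Psi & forall x,
    (forall i, (i <= I)%N -> mm t i (Psi x) = sg (sigma i) (mm t i x)) /\
    (forall k, (t < k <= T)%N -> Z k (Psi x) = sg (tau k) (Z k x)).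
Proof.
elim: t sigma tau => [|t IH] sigma tau tT.
  (* At time 0 the only nonzero mismatch is the first, equal to [Z 0]. *)
  have [Psi PsiP PsiE] := flipZ (fun k => if k == 0%N then sigma 1%N else tau k).
  exists Psi => // x; split=> [i _|k /andP[k0 kT]]; last first.
    by rewrite PsiE// gtn_eqF.
  by rewrite /mm /=; have [->|_] := eqVneq i 1%N; rewrite ?sg0// PsiE.
(* [c i] tells whether hop [i] transmits; the content of mismatch [i] then needs the sign wanted at
   its next place, [i] or [i + 1]. *)
pose sig (c : {ffun 'I_I.+1 -> bool}) i := sigma (i + c (inord i))%N.
(* The innovation of time [t + 1] lands in mismatch 1 and takes its sign. *)
pose tau' k := if k == t.+1 then sigma 1%N else tau k.
have /choice[Psi PsiP] : forall c, exists Psi, measure_preserving mu Psi /\ forall x,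
    (forall i, (i <= I)%N -> mm t i (Psi x) = sg (sig c i) (mm t i x)) /\
    (forall k, (t < k <= T)%N -> Z k (Psi x) = sg (tau' k) (Z k x)).
  by move=> c; have [Psi ? ?] := IH (sig c) tau' (ltnW tT); exists Psi.
pose pat x : {ffun 'I_I.+1 -> bool} := [ffun i : 'I_I.+1 => rho t i (mm t i x)].
exists (fun x => Psi (pat x) x).
  apply: preserving_piecewise => [c|c|c x].
  - have -> : pat @^-1` [set c] = \bigcap_(i in [set: 'I_I.+1])
        ((fun x => rho t i (mm t i x)) @^-1` [set c i]).
      apply/seteqP; split=> x /=.
        by move=> <- i _; rewrite /= ffunE.
      by move=> h; apply/ffunP => i; rewrite ffunE; exact: h.
    apply: fin_bigcap_measurable; first exact: finite_finset.
    move=> i _; rewrite -[X in measurable X]setTI.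
    by apply: (mrho t i (mvec_mm t i)).
  - by case: (PsiP c).
  - apply/ffunP => i; rewrite !ffunE.
    by have [_ /(_ x)[-> //]] := PsiP c; rewrite ?rho_sg// -ltnS.
move=> x; have [_ /(_ x)[PsiM PsiZ]] := PsiP (pat x).
have sigE i : (i <= I)%N -> sig (pat x) i = sigma (i + rho t i (mm t i x))%N.
  by move=> iI; rewrite /sig ffunE inordK.
split=> [i iI|k /andP[tk kT]]; last first.
  by rewrite PsiZ ?(ltnW tk)// /tau' gtn_eqF.
have unsentE j : (j <= I)%N ->
    (if rho t j (mm t j (Psi (pat x) x)) then 0 else mm t j (Psi (pat x) x)) =
    sg (sigma j) (if rho t j (mm t j x) then 0 else mm t j x).
  move=> jI; rewrite PsiM// rho_sg sigE//.
  by case: (rho t j (mm t j x)); rewrite ?sg0 ?addn0.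
case: i iI => [|[|i]] iI; rewrite /mm /=; first by rewrite sg0.
  by rewrite -/(mm t 1 _) unsentE// -/(mm t 1 _) sgD sg_mul PsiZ ?tT ?leqnn//
    /tau' eqxx.
rewrite -sg_mul sgD -!/(mm t _ _) unsentE//; congr (_ *m (_ + _)).
rewrite PsiM ?(ltnW iI)// rho_sg sigE ?(ltnW iI)//.
by case: (rho t i.+1 (mm t i.+1 x)); rewrite ?sg0 ?addn1.
Qed.

(** The three parts of [DmS] are separated by two sign flips. *)
Lemma Ex_quad_DmS (G : 'M[R]_n) t j : psd G -> (t < T)%N -> (j < I)%N ->
  Ex mu (fun x => quad G (Dm t.+1 j.+2 x)) =
  (Ex mu (fun x => quad G (Z t.+1 x)) +
   (Ex mu (fun x => quad (A^T *m G *m A) (Dm t j.+1 x)) +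
    Ex mu (fun x => quad (A^T *m G *m A) (unsent t j.+1 x))))%E.
Proof.
move=> pG tT jI; have [_ G0] := pG.
have Dfix i sigma Psi (x : X) : (i <= I.+1)%N -> (forall l, (l < i)%N -> sigma l = false) ->
    (forall l, (l <= I)%N -> mm t l (Psi x) = sg (sigma l) (mm t l x)) ->
    Dm t i (Psi x) = Dm t i x.
  move=> iI sl h; apply: eq_big_nat => l /andP[_ li].
  by rewrite h ?sl// -ltnS (leq_trans li).
have unsg i sigma Psi (x : X) : (i <= I)%N ->
    (forall l, (l <= I)%N -> mm t l (Psi x) = sg (sigma l) (mm t l x)) ->
    unsent t i (Psi x) = sg (sigma i) (unsent t i x).
  by move=> iI h; rewrite /unsent h// rho_sg; case: ifP => _; rewrite ?sg0.
(* First flip: innovations after [t] are negated, mismatches at [t] are kept. *)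
have [Psi PsiP PsiE] := flip_mm (fun=> false) (fun=> true) (ltnW tT).
have mDU : mvec (fun x => A *m (Dm t j.+1 x + unsent t j.+1 x)).
  by apply: mvec_mul; apply: mvecD; [exact: mvec_Dm|exact: mvec_unsent].
transitivity (Ex mu (fun x => quad G (A *m (Dm t j.+1 x + unsent t j.+1 x) + Z t.+1 x))).
  by apply: eq_Ex => x; rewrite DmS addrC.
rewrite (Ex_quad_orthogonal G0 mDU (mZ _) PsiP); last 2 first.
- move=> x; have [h _] := PsiE x.
  by rewrite (Dfix _ _ _ _ _ _ h)// 1?(unsg _ _ _ _ _ h)// ltnW.
- by move=> x; have [_ ->] := PsiE x; rewrite // ltnSn tT.
rewrite addeC; congr (_ + _)%E.
(* Second flip: at time [t] only mismatch [j + 1] is negated. *)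
have [Psi' PsiP' PsiE'] := flip_mm (fun i => i == j.+1) (fun=> true) (ltnW tT).
rewrite -(Ex_quad_orthogonal _ (mvec_Dm _ _) (mvec_unsent _ _) PsiP').
- by apply: eq_Ex => x; rewrite quad_mul.
- by case: (psd_mul A pG).
- move=> x; have [h _] := PsiE' x; apply: (Dfix _ _ _ _ _ _ h); first exact: ltnW.
  by move=> l lj; rewrite ltn_eqF.
- by move=> x; have [h _] := PsiE' x; rewrite (unsg _ _ _ _ _ h)// eqxx.
Qed.

Definition conjpow (G : 'M[R]_n) e := (mxpow A e)^T *m G *m mxpow A e.

Lemma conjpowS G e : conjpow (A^T *m G *m A) e = conjpow G e.+1.
Proof. by rewrite /conjpow /= trmx_mul !mulmxA. Qed.

Lemma conjpow0 G : conjpow G 0 = G.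
Proof. by rewrite /conjpow /= trmx1 mul1mx mulmx1. Qed.

(** Each unrolling of [Ex_quad_DmS] goes back one instant and one hop, conjugates the weight by [A],
    and releases one innovation and one untransmitted mismatch. Only the second sum involves the
    rule. *)
Lemma Ex_quad_Dm (G : 'M[R]_n) t j : psd G -> (t <= T)%N -> (j <= I)%N ->
  Ex mu (fun x => quad G (Dm t j.+1 x)) =
  (\sum_(e < j) (if (e <= t)%N then
       Ex mu (fun x => quad (conjpow G e) (Z (t - e)%N x)) else 0) +
   \sum_(e < j) (if (e < t)%N then
       Ex mu (fun x => quad (conjpow G e.+1) (unsent (t - e.+1)%N (j - e)%N x)) else 0))%E.
Proof.
elim: j t G => [|j IH] t G pG tT jI.
  rewrite !big_ord0 adde0 Ex_eq0// => x.
  by rewrite /Dm big_geq// quad0.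
case: t tT => [_|t tT].
  rewrite big_ord_recl /= subn0 conjpow0 !big1 ?adde0//.
  apply: eq_Ex => x; congr (quad _ _).
  rewrite /Dm big_ltn// big1_seq ?addr0// => i /andP[_].
  by rewrite mem_index_iota => /andP[i2 _]; rewrite /mm /= gtn_eqF.
rewrite Ex_quad_DmS// (IH t _ (psd_mul A pG) (ltnW tT) (ltnW jI)).
rewrite !big_ord_recl /= conjpow0 !subn0.
rewrite -[RHS]addeA; congr (_ + _)%E.
rewrite -[LHS]addeA; congr (_ + _)%E.
  by apply: eq_bigr => e _; rewrite /bump /= add1n ltnS subSS conjpowS.
rewrite addeC; congr (_ + _)%E.
  by rewrite subSS subn0 -conjpowS conjpow0.
apply: eq_bigr => e _; rewrite /bump /= add1n ltnS !subSS.
by rewrite conjpowS.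
Qed.

End mismatch.

(** * Comparison of the policies *)

Section canonical_comparison.
Variables (R : realType) (n m p L T : nat).
Variables (A : 'M[R]_n) (B : 'M[R]_(n, m)) (C : 'M[R]_(p, n)).
Variables (Q : 'M[R]_n) (Rc : 'M[R]_m) (Lam : 'M[R]_n).
Variables (Gw : nat -> 'M[R]_n) (Gv : nat -> 'M[R]_p) (G0 : 'M[R]_n).
Variable s : seq nidx.
Local Notation X := (gspace R (size s)).
Local Notation gcs := (@gc R s).
Hypothesis us : uniq s.
Hypothesis s0 : forall i, (i < n)%N -> I0 i \in s.
Hypothesis sw : forall k i, (k < T)%N -> (i < n)%N -> IW k i \in s.
Hypothesis sv : forall k i, (k <= T)%N -> (i < p)%N -> IV k i \in s.
Variable mu : {measure set X -> \bar R}.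
Hypothesis muG : std_gaussian mu.
Hypotheses (psdQ : psd Q) (psdLam : psd Lam) (pdR : pd Rc).
Hypothesis unit_innov :
  forall k, C *m Pprior A C Gw Gv G0 k *m C^T + Vc Gv k \in unitmx.
Local Notation S := (Sric A B Q Rc Lam T).
Local Notation Gamma := (Gam A B Q Rc Lam T).
Local Notation Wms := (Wm Gw s).
Local Notation Vms := (Vm Gv s).
Local Notation Em := (Emm A C Gw Gv G0 (X0m G0 s) Wms Vms).
Local Notation Nm := (Num A C Gw Gv G0 (X0m G0 s) Wms Vms).
Local Notation zet := (@zeta R n p A C Gw Gv G0 s).

Let unc : uncorrelated T Gw Gv G0 (X0m G0 s) Wms Vms.
Proof. exact: uncorrelated_noise. Qed.

Lemma mvec_zeta k : mvec (zet k).
Proof. by apply: mvec_mul; exact: mvec_lin. Qed.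

(** Innovations at different times are uncorrelated, so the reflection negating one fixes the
    others; a product of such reflections realizes any sign pattern. *)
Lemma flip_zeta (tau : nat -> bool) : exists2 Psi, measure_preserving mu Psi &
  forall k x, (k <= T)%N -> zet k (Psi x) = sg (tau k) (zet k x).
Proof.
suff [U Up UE] : exists2 U, preserves mu U & forall k, (k <= T)%N ->
    Nm k *m U = if tau k then - Nm k else Nm k.
  exists (fun x => U *m x : 'cV[R]_(size s)) => // k x kT.
  rewrite /zeta (mulmxA _ U) UE//; case: (tau k) => //=.
  by rewrite mulNmx mulmxN.
suff /(_ T.+1)[U Up UE] : forall b, exists2 U, preserves mu U & forall k, (k <= T)%N ->
    Nm k *m U = if tau k && (k < b)%N then - Nm k else Nm k.
  by exists U => // k kT; rewrite UE// ltnS kT andbT.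
elim=> [|b [U Up UE]].
  by exists 1%:M => [|k _]; [exact: preserves1|rewrite ltn0 andbF mulmx1].
have [/andP[tb bT]|nb] := boolP (tau b && (b <= T)%N); last first.
  exists U => // k kT; rewrite UE// ltnS [(k <= b)%N]leq_eqVlt.
  have [kb|] := eqVneq k b; last by [].
  by move: nb; rewrite -kb kT andbT => /negbTE ->.
have [V [Vp VN Vfix]] := reflection_ex muG (Nm b).
exists (V *m U) => [|k kT]; first exact: preservesM.
rewrite mulmxA ltnS [(k <= b)%N]leq_eqVlt; have [->|kb] := eqVneq k b.
  by rewrite VN mulNmx UE// tb ltnn.
by rewrite Vfix ?UE//; apply: (Num_Num unc unit_innov).
Qed.

Section rule.
Variables (pi : rule R n) (rho : nat -> nat -> 'cV[R]_n -> bool).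
Hypothesis piE : forall k h j, pi k h j = rho k j (h j - h j.+1).
Hypothesis rhoN : forall k j v, rho k j (- v) = rho k j v.
Hypothesis mrho : forall k j f, mvec f -> measurable_fun setT (fun x : X => rho k j (f x)).
Local Notation xx := (state L T A B C Q Rc Lam Gw Gv G0 gcs pi).
Local Notation xh := (est L T A B C Q Rc Lam Gw Gv G0 gcs pi).
Local Notation uu := (input L T A B C Q Rc Lam Gw Gv G0 gcs pi).
Local Notation del := (delta L T A B C Q Rc Lam Gw Gv G0 gcs pi).
Local Notation mmr := (mm A zet rho).
Local Notation Dr := (Dm A zet rho).
Local Notation unsentr := (unsent A zet rho).

Lemma mrule_rho : mrule s pi.
Proof.
move=> f mf k j; under eq_fun do rewrite piE.
by apply: mrho; exact: mvecB.
Qed.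

(** The input enters all estimates alike and cancels in differences, which leaves the recursion of
    [mmz]. *)
Lemma mm_est t j x : xh t x j.+1 - xh t x j.+2 = mmr t j.+1 x.
Proof.
elim: t j => [|t IH] j.
  case: j => [|j]; last by rewrite /mm /est /= subrr.
  by rewrite est10 /est /= subr0.
have delE i : del t i.+1 x = rho t i.+1 (mmr t i.+1 x) by rewrite /delta piE IH.
case: j => [|j].
  rewrite est1S estS delE mmS1.
  have zz (a u z b : 'cV[R]_n) : a + u + z - (b + u) = z + (a - b).
    by rewrite addrAC opprD addrACA subrr addr0 addrC.
  rewrite zz -mulmxBr; congr (_ + _ *m _).
  by rewrite /unsent -IH; case: ifP => _; rewrite ?subrr.
rewrite !estS !delE opprD addrACA subrr addr0 -mulmxBr.
rewrite mmS /unsent -!IH; congr (_ *m _).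
by case: ifP => _; case: ifP => _; rewrite ?subrr ?addr0 ?add0r// addrA subrK.
Qed.

Lemma Dm_est t j x : xh t x 1%N - xh t x j.+1 = Dr t j.+1 x.
Proof.
elim: j => [|j IH]; first by rewrite subrr /Dm big_geq.
by rewrite /Dm big_nat_recr//= -/(Dr t j.+1 x) -IH -mm_est addrA subrK.
Qed.

(** The reflection negating the Kalman error at [t] fixes all innovations up to [t], hence the
    mismatches. *)
Lemma Ex_quad_error t : (t <= T)%N ->
  (Ex mu (fun x => quad (Gamma t) (xx t x - xh t x L.+1)%R) =
   Ex mu (fun x => quad (Gamma t) (Em t *m (x : 'cV[R]_(size s)))) +
   Ex mu (fun x => quad (Gamma t) (Dr t L.+1 x)))%E.
Proof.
move=> tT; have [U [Up UE Ufix]] := reflection_ex muG (Em t).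
rewrite addeC -(Ex_quad_orthogonal (a := Dr t L.+1)
  (b := fun x : X => Em t *m (x : 'cV[R]_(size s)))
  (proj2 (psd_Gam A B T psdQ psdLam pdR t)) _ _ Up).
- apply: eq_Ex => x; rewrite -Dm_est -(@error_lin _ _ _ _ L T _ B _ Q Rc Lam _ _ _ _ pi).
  by congr (quad _ _); rewrite [RHS]addrC addrA subrK.
- by apply: mvec_Dm => //; exact: mvec_zeta.
- exact: mvec_lin.
- move=> x; rewrite /Dm; apply: eq_bigr => i _; apply: mmz_ext => k kt.
  rewrite /zeta (mulmxA (Nm k)) Ufix//.
  rewrite -[LHS]trmxK trmx_mul trmxK (Emm_Num unc unit_innov) ?trmx0//.
  by rewrite kt tT.
- by move=> x; rewrite mulmxA UE mulNmx.
Qed.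

(** The part of the cost common to all rules. *)
Definition base_cost : \bar R :=
  (Ex mu (fun x => quad (S 0%N) (x0 G0 gcs x)) +
  \sum_(t < T) (Ex mu (fun x => quad (Gamma t) (Em t *m (x : 'cV[R]_(size s)))) +
    \sum_(e < L) (if (e <= t)%N then
       Ex mu (fun x => quad (conjpow A (Gamma t) e) (zet (t - e)%N x)) else 0) +
    Ex mu (fun x => quad (S t.+1) (wn Gw gcs t x))))%E.

Lemma sum_shift (e : nat) (f : nat -> \bar R) :
  (\sum_(t < T) (if (e < t)%N then f t else 0) =
   \sum_(k < T) (if (k + e.+1 < T)%N then f (k + e.+1)%N else 0))%E.
Proof.
rewrite -(big_mkord xpredT (fun t => if (e < t)%N then f t else 0%E)).
rewrite -(big_mkord xpredT (fun k => if (k + e.+1 < T)%N then f (k + e.+1)%N else 0%E)).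
rewrite -!big_mkcond /= -(@big_nat_widenl _ _ _ e.+1 0 T xpredT)//.
rewrite -{1}[e.+1]add0n big_addn.
rewrite (@big_nat_widen _ _ _ 0 (T - e.+1) T xpredT) ?leq_subr//=.
by apply: eq_bigl => k; rewrite ltn_subRL addnC.
Qed.

(** Summing by decision time instead of cost time: what hop [L - e] withholds at time [k] is charged
    at time [k + e + 1], and only if that is before [T]. *)
Lemma cost_decomposition :
  (Ex mu (fun x => (quad Lam (xx T x) +
     \sum_(k < T) (quad Q (xx k x) + quad Rc (uu k x)))%R) =
   base_cost + \sum_(e < L) \sum_(k < T) (if (k + e.+1 < T)%N then
     Ex mu (fun x => quad (conjpow A (Gamma (k + e.+1)) e.+1)
                          (unsentr k (L - e)%N x)) else 0))%E.
Proof.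
have AC (a b c w : \bar R) : (a + (b + c) + w = a + b + w + c)%E.
  by rewrite -!addeA (addeC w).
rewrite cost_eq//; last exact: mrule_rho.
rewrite /base_cost -[RHS]addeA.
congr (_ + _)%E.
transitivity (\sum_(t < T) (Ex mu (fun x => quad (Gamma t) (Em t *m (x : 'cV[R]_(size s)))) +
    \sum_(e < L) (if (e <= t)%N then
       Ex mu (fun x => quad (conjpow A (Gamma t) e) (zet (t - e)%N x)) else 0) +
    Ex mu (fun x => quad (S t.+1) (wn Gw gcs t x)) +
    \sum_(e < L) (if (e < t)%N then Ex mu (fun x =>
       quad (conjpow A (Gamma t) e.+1) (unsentr (t - e.+1)%N (L - e)%N x)) else 0)))%E.
  apply: eq_bigr => t _; have tT := ltnW (ltn_ord t).
  rewrite Ex_quad_error// (@Ex_quad_Dm _ _ _ mu _ T L _ _ _ rhoN mrho mvec_zeta flip_zeta)//.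
  exact: psd_Gam.
rewrite big_split /=; congr (_ + _)%E; rewrite exchange_big /=; apply: eq_bigr => e _.
rewrite (sum_shift e (fun t => Ex mu (fun x =>
  quad (conjpow A (Gamma t) e.+1) (unsentr (t - e.+1)%N (L - e)%N x)))).
by apply: eq_bigr => k _; rewrite addnK.
Qed.

Definition penalty (k e : nat) : \bar R :=
  if (k + e.+1 < T)%N then
    Ex mu (fun x => quad (conjpow A (Gamma (k + e.+1)) e.+1) (unsentr k (L - e)%N x))
  else 0%E.

Variable lam : nat -> R.
Hypothesis lam0 : forall j, (1 <= j <= L)%N -> 0 <= lam j.

Lemma lagrangian_decomposition :
  (Ex mu (fun x => (quad Lam (xx T x) +
     \sum_(k < T) (quad Q (xx k x) + quad Rc (uu k x)))%R) +
   \sum_(1 <= j < L.+1) (lam j)%:E *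
     Ex mu (fun x => (\sum_(k < T) ((del k j x : nat)%:R : R))%R) =
   base_cost + \sum_(e < L) \sum_(k < T) (penalty k e +
     Ex mu (fun x => (lam (L - e)%N * (del k (L - e)%N x : nat)%:R)%R)))%E.
Proof.
have md k j : measurable_fun setT (fun x => (del k j x : nat)%:R : R).
  apply: (eq_measurable_fun (fun x => if del k j x then 1 else 0 : R)).
    by move=> x _; case: (del k j x).
  apply: measurable_fun_ifT => //.
  by apply: measurable_delta; exact: mrule_rho.
rewrite cost_decomposition -[LHS]addeA; congr (_ + _)%E.
(* The hops are counted from the controller, [j = L - e], to match the penalties. *)
rewrite big_add1 /= big_mkord [X in (_ + X)%E](reindex_inj rev_ord_inj) /=.
rewrite -big_split /=.
apply: eq_bigr => e _; rewrite subnSK//.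
rewrite [RHS]big_split /=; congr (_ + _)%E.
have l0 : 0 <= lam (L - e)%N by apply: lam0; rewrite subn_gt0 ltn_ord leq_subr.
rewrite (@Ex_sum _ _ _ mu _ _ (fun (k : 'I_T) x => (del k (L - e)%N x : nat)%:R))//.
rewrite ge0_sume_distrr; last by move=> k _; exact: Ex_ge0.
by apply: eq_bigr => k _; rewrite ExZ.
Qed.

End rule.

Variable lam : nat -> R.
Hypothesis lam0 : forall j, (1 <= j <= L)%N -> 0 <= lam j.

Definition lagrangian (pi : rule R n) := (Ex mu (fun x =>
    (quad Lam (state L T A B C Q Rc Lam Gw Gv G0 gcs pi T x) +
     \sum_(k < T) (quad Q (state L T A B C Q Rc Lam Gw Gv G0 gcs pi k x) +
                   quad Rc (input L T A B C Q Rc Lam Gw Gv G0 gcs pi k x)))%R) +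
   \sum_(1 <= j < L.+1) (lam j)%:E *
     Ex mu (fun x => (\sum_(k < T)
       ((delta L T A B C Q Rc Lam Gw Gv G0 gcs pi k j x : nat)%:R : R))%R))%E.

(** The dVoI rule as a function of one mismatch; it is even because a quadratic form is. *)
Let rho1 k j (v : 'cV[R]_n) :=
  (k + (L.+1 - j) <= T)%N &&
  (lam j - quad (conjpow A (Gamma (k + (L.+1 - j))) (L.+1 - j)) v < 0).
Let rho2 k (j : nat) (v : 'cV[R]_n) := (k <= T.-1)%N.

Let mrho1 k j f : mvec f -> measurable_fun setT (fun x : X => rho1 k j (f x)).
Proof.
move=> mf; apply: measurable_and => //; apply: measurable_fun_ltr => //.
by apply: measurable_funB => //; exact: measurable_quad.
Qed.

Lemma mrule_dvoi : mrule s (dvoi_policy L T A B Q Rc Lam lam).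
Proof. by apply: mrule_rho mrho1 => k h j. Qed.

Lemma mrule_periodic : mrule s (@periodic_policy R n T).
Proof. by move=> f _ k j; exact: measurable_cst. Qed.

(** The comparison holds term by term, [lam j] separating the two sides for every time and hop. *)
Lemma canonical_comparison :
  (lagrangian (dvoi_policy L T A B Q Rc Lam lam) <= lagrangian (@periodic_policy R n T))%E.
Proof.
have rho1N k j v : rho1 k j (- v) = rho1 k j v by rewrite /rho1 quadN.
have E1 k h j : dvoi_policy L T A B Q Rc Lam lam k h j = rho1 k j (h j - h j.+1) by [].
have E2 k h j : @periodic_policy R n T k h j = rho2 k j (h j - h j.+1) by [].
rewrite /lagrangian (lagrangian_decomposition E1 rho1N mrho1 lam0).
rewrite (lagrangian_decomposition E2 (fun _ _ _ => erefl) _ lam0); last first.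
  by move=> k j f _; exact: measurable_cst.
apply: leeD => //; apply: lee_sum => e _; apply: lee_sum => k _.
set j := (L - e)%N.
have l0 : 0 <= lam j by apply: lam0; rewrite subn_gt0 ltn_ord leq_subr.
have Lj : (L.+1 - j = e.+1)%N by rewrite /j subSn ?leq_subr// subKn// ltnW.
have psdC t := psd_mul (mxpow A e.+1) (psd_Gam A B T psdQ psdLam pdR t).
have -> : Ex mu (fun x => lam j *
    (delta L T A B C Q Rc Lam Gw Gv G0 gcs (@periodic_policy R n T) k j x : nat)%:R) =
    Ex mu (fun=> lam j).
  apply: eq_Ex => x; rewrite /delta /periodic_policy -ltnS prednK ?ltn_ord ?mulr1//.
  exact: leq_ltn_trans (ltn_ord k).
have pen0 : (0 <= penalty rho2 k e)%E.
  rewrite /penalty; case: ifP => // _; apply: Ex_ge0 => x.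
  exact: (proj2 (psdC _)).
(* The periodic rule always pays the price, so its term is at least [lam j]. *)
apply: le_trans (leeDr _ pen0); rewrite /penalty -/j.
have delE x : delta L T A B C Q Rc Lam Gw Gv G0 gcs
    (dvoi_policy L T A B Q Rc Lam lam) k j x = rho1 k j (mm A zet rho1 k j x).
  rewrite /delta E1; have j0 : (0 < j)%N by rewrite subn_gt0.
  by rewrite -(prednK j0) (mm_est E1).
have mmm := mvec_mm A mrho1 mvec_zeta k j.
have mdel : measurable_fun setT (fun x : X => lam j * (rho1 k j (mm A zet rho1 k j x) : nat)%:R).
  apply: (eq_measurable_fun (fun x => if rho1 k j (mm A zet rho1 k j x) then lam j else 0)).
    by move=> x _; case: (rho1 _ _ _); rewrite ?mulr1 ?mulr0.
  by apply: measurable_fun_ifT => //; exact: mrho1.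
have -> : Ex mu (fun x => lam j * (delta L T A B C Q Rc Lam Gw Gv G0 gcs
    (dvoi_policy L T A B Q Rc Lam lam) k j x : nat)%:R) =
    Ex mu (fun x => lam j * (rho1 k j (mm A zet rho1 k j x) : nat)%:R).
  by apply: eq_Ex => x; rewrite delE.
have d0 (x : X) : 0 <= lam j * (rho1 k j (mm A zet rho1 k j x) : nat)%:R.
  by rewrite mulr_ge0.
have mun := mvec_unsent A mrho1 mvec_zeta k j.
(* From [k + e + 1 = T] on there is no penalty, and a decision costs at most [lam j]. *)
case: ifP => [keT|_]; last first.
  rewrite add0e; apply: le_Ex => // x.
  by case: (rho1 _ _ _); rewrite ?mulr1 ?mulr0.
have q0 (x : X) : 0 <= quad (conjpow A (Gamma (k + e.+1)) e.+1) (unsent A zet rho1 k j x).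
  exact: (proj2 (psdC _)).
rewrite -ExD//; last exact: measurable_quad.
apply: le_Ex => //.
- by apply: measurable_funD => //; exact: measurable_quad.
- by move=> x; rewrite addr_ge0.
(* Transmitting costs exactly [lam j]; staying silent means [dVoI >= 0], which bounds the penalty by
   [lam j]. *)
move=> x; rewrite /unsent; case: ifP => [_|r]; first by rewrite quad0 add0r mulr1.
by move: r; rewrite /rho1 Lj (ltnW keT) /= subr_lt0 mulr0 addr0 => /negbT; rewrite -leNgt.
Qed.


End canonical_comparison.

(** * Transfer from the given probability space to the canonical one *)

Section transfer.
Context d (Omega : measurableType d) (R : realType) (P : probability Omega R).
Variables (n m p L T : nat).
Variables (A : 'M[R]_n) (B : 'M[R]_(n, m)) (C : 'M[R]_(p, n)).
Variables (Q : 'M[R]_n) (Rc : 'M[R]_m) (Lam : 'M[R]_n).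
Variables (Gw : nat -> 'M[R]_n) (Gv : nat -> 'M[R]_p) (G0 : 'M[R]_n).
Variables (g : nidx -> Omega -> R) (s : seq nidx).
Hypothesis us : uniq s.
Hypothesis s0 : forall i, (i < n)%N -> I0 i \in s.
Hypothesis sw : forall k i, (k < T)%N -> (i < n)%N -> IW k i \in s.
Hypothesis sv : forall k i, (k <= T)%N -> (i < p)%N -> IV k i \in s.
Hypotheses (psdQ : psd Q) (psdLam : psd Lam) (pdR : pd Rc).
Hypothesis gN : std_normal_family P g.
Variable mu : {measure set (gspace R (size s)) -> \bar R}.
Hypothesis muE : (mu : set (gspace R (size s)) -> \bar R) = pushforward P (xi s g).

Lemma Ex_xi (F : gspace R (size s) -> R) : measurable_fun setT F ->
  (forall x, 0 <= F x) -> (\int[P]_w (F (xi s g w))%:E)%E = Ex mu F.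
Proof.
move=> mF F0; rewrite /Ex muE (ge0_integral_pushforward (measurable_xi (s := s) gN))//.
- exact/measurable_EFinP.
- by move=> x _; rewrite lee_fin.
Qed.

Lemma cl_xi pi k w : (k <= T)%N ->
  cl L T A B C Q Rc Lam Gw Gv G0 g pi k w =
  cl L T A B C Q Rc Lam Gw Gv G0 (@gc R s) pi k (xi s g w).
Proof.
move=> kT; apply: cl_ext => [|l lk|l lk].
- by congr (_ *m _); apply/matrixP => i j; rewrite !mxE gc_xi//; exact: s0.
- congr (_ *m _); apply/matrixP => i j; rewrite !mxE gc_xi//.
  by apply: sw => //; exact: leq_trans kT.
- congr (_ *m _); apply/matrixP => i j; rewrite !mxE gc_xi//.
  by apply: sv => //; exact: leq_trans kT.
Qed.

(** Up to the horizon the loop factors through the finite noise vector [xi], so expectations are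
    integrals against its law. *)
Lemma Lagr_xi (lam : nat -> R) pi : mrule s pi ->
  Lagr L T A B C Q Rc Lam Gw Gv G0 g P lam pi =
  lagrangian L T A B C Q Rc Lam Gw Gv G0 mu lam pi.
Proof.
move=> mpi; rewrite /Lagr /lagrangian; congr (_ + _)%E.
  rewrite -Ex_xi; last 2 first.
  - apply: measurable_funD; first by apply: measurable_quad; exact: mvec_state.
    apply: measurable_sum => k; apply: measurable_funD; apply: measurable_quad.
      exact: mvec_state.
    exact: mvec_input.
  - move=> x; rewrite addr_ge0 ?(proj2 psdLam)// sumr_ge0// => k _.
    rewrite addr_ge0 ?(proj2 psdQ)//; case: pdR => _ R0.
    set u := input _ _ _ _ _ _ _ _ _ _ _ _ _ _ _.
    by have [->|/R0/ltW//] := eqVneq u 0; rewrite quad0.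
  apply: eq_integral => w _; congr (_%:E).
  rewrite /state cl_xi//; congr (_ + _); apply: eq_bigr => k _.
  by rewrite /input /est !cl_xi// ltnW.
apply: eq_bigr => j _; congr (_ * _)%E; rewrite -Ex_xi.
- apply: eq_integral => w _; congr (_%:E); apply: eq_bigr => k _.
  by rewrite /delta /est cl_xi// ltnW.
- apply: measurable_sum => k.
  apply: (eq_measurable_fun (fun x =>
    if delta L T A B C Q Rc Lam Gw Gv G0 (@gc R s) pi k j x then 1 else 0 : R)).
    by move=> x _; case: (delta _ _ _ _ _ _ _ _ _ _ _ _ _ _ _ _).
  by apply: measurable_fun_ifT => //; exact: measurable_delta.
- by move=> x; apply: sumr_ge0.
Qed.

End transfer.

Theorem theorem3
  (d : measure_display) (Omega : measurableType d) (R : realType)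
  (P : probability Omega R)
  (n m p L T : nat)
  (A : 'M[R]_n) (B : 'M[R]_(n, m)) (C : 'M[R]_(p, n))
  (Q : 'M[R]_n) (Rc : 'M[R]_m) (Lam : 'M[R]_n)
  (Gw : nat -> 'M[R]_n) (Gv : nat -> 'M[R]_p) (G0 : 'M[R]_n)
  (g : nidx -> Omega -> R)
  (lam : nat -> R) :
  (1 <= L)%N ->
  psd Q -> psd Lam -> pd Rc ->
  (forall k, C *m Pprior A C Gw Gv G0 k *m C^T + Vc Gv k \in unitmx) ->
  std_normal_family P g ->
  mutually_independent P g ->
  (forall j, (1 <= j <= L)%N -> 0 <= lam j) ->
  (Lagr L T A B C Q Rc Lam Gw Gv G0 g P lam
     (dvoi_policy L T A B Q Rc Lam lam)
   <= Lagr L T A B C Q Rc Lam Gw Gv G0 g P lam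
     (@periodic_policy R n T))%E.
Proof.
move=> _ psdQ psdLam pdR unit_innov gN gI lam0.
(* All scalars read within the horizon: [x_0], [w_k] for [k < T], and [v_k] for [k <= T]. *)
pose s := undup ([seq I0 i | i <- iota 0 n] ++
  [seq IW k i | k <- iota 0 T, i <- iota 0 n] ++
  [seq IV k i | k <- iota 0 T.+1, i <- iota 0 p]).
have us : uniq s by exact: undup_uniq.
have s0 i : (i < n)%N -> I0 i \in s.
  by move=> i_n; rewrite mem_undup !mem_cat map_f ?mem_iota.
have sw k i : (k < T)%N -> (i < n)%N -> IW k i \in s.
  move=> kT i_n; rewrite mem_undup 2!mem_cat; apply/orP; right; apply/orP; left.
  by apply: (allpairs_f IW); rewrite mem_iota.
have sv k i : (k <= T)%N -> (i < p)%N -> IV k i \in s.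
  move=> kT i_p; rewrite mem_undup 2!mem_cat; apply/orP; right; apply/orP; right.
  by apply: (allpairs_f IV); rewrite mem_iota.
pose pm : {measure set (gspace R (size s)) -> \bar R} := pushforward P (xi s g).
pose mu := pm (measurable_xi (s := s) gN).
have muG : std_gaussian mu by exact: std_gaussian_xi.
have LE pi : mrule s pi -> Lagr L T A B C Q Rc Lam Gw Gv G0 g P lam pi =
    lagrangian L T A B C Q Rc Lam Gw Gv G0 mu lam pi by exact: Lagr_xi.
rewrite !LE; [|exact: mrule_periodic|exact: mrule_dvoi].
exact: canonical_comparison.
Qed.
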